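(* Let $\{\mathcal{T}_h\}_{h>0}$ be a regular family of tetrahedral triangulations of a domain $\Omega\subset\mathbb{R}^3$ with stability constant $\alpha$, and for each $h$ let $\Gamma_h\subset\Omega$ be a connected $C^{0,1}$ surface without boundary that is consistent with $\mathcal{T}_h$. Assume that any quadrilateral element $S\cap\Gamma_h$, $S\in\mathcal{T}_h$, is divided into two triangles by connecting the vertex with largest inner angle with its opposite vertex, and let $\mathcal{F}_h$ be the resulting set of triangles, so that $\Gamma_h=\bigcup_{T\in\mathcal{F}_h}T$. Then the resulting surface triangulation satisfies the following maximal angle condition: there exists $\phi_{\min}>0$, depending only on $\alpha$, such that \[ 0<\sup_{T\in\mathcal{F}_h}\phi_{i,T}\le \pi-\phi_{\min},\qquad i=1,2,3, \] where $\phi_{1,T},\phi_{2,T},\phi_{3,T}$ are the inner angles of the triangle $T$.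
   Context: Tetrahedral triangulations: a family $\{\mathcal{T}_h\}_{h>0}$ of tetrahedral triangulations of $\Omega\subset\mathbb{R}^3$ is called regular with stability constant $\alpha$ if each $\mathcal{T}_h$ contains no hanging nodes (it is a consistent/conforming subdivision) and \[ \sup_{h>0}\sup_{S\in\mathcal{T}_h}\rho(S)/r(S)\le\alpha<\infty, \] where $\rho(S)$ and $r(S)$ are the diameters of the smallest ball that contains $S$ and of the largest ball contained in $S$, respectively. For simplicity of presentation the family is also assumed to be quasi-uniform; this is not essential, and $\phi_{\min}$ depends only on $\alpha$. Consistency: a surface $\Gamma_h$ is called consistent with the outer triangulation $\mathcal{T}_h$ if for every tetrahedron $S\in\mathcal{T}_h$ with $\mathrm{meas}_2(S\cap\Gamma_h)>0$ the set $S\cap\Gamma_h$ is planar. Each such set $S\cap\Gamma_h$ is then either a triangle or a quadrilateral, and is called a (triangular or quadrilateral) element. (Typical example: $\Gamma_h$ is the zero level set of a continuous function that is affine on each tetrahedron of $\mathcal{T}_h$.) *)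

(* Defs.v *)
From mathcomp Require Import all_boot all_order all_algebra.
From mathcomp Require Import all_classical all_reals all_analysis.
Set Implicit Arguments.
Unset Strict Implicit.
Unset Printing Implicit Defensive.
Import Order.TTheory GRing.Theory Num.Theory.
Import numFieldNormedType.Exports.

Local Open Scope classical_set_scope.
Local Open Scope ring_scope.

(* The library norm on 'rV[R]_3 is the sup norm; it is used only through the
   topology it induces.  All metric notions (balls, diameters, angles) below
   use the Euclidean norm. *)
Notation pt R := 'rV[R]_3.

Definition dotp (R : realType) (u v : pt R) : R := \sum_(i < 3) u 0 i * v 0 i.

Definition enorm (R : realType) (u : pt R) : R := Num.sqrt (dotp u u).

Definition edist (R : realType) (x y : pt R) : R := enorm (x - y).

(* Closed ball of DIAMETER d. *)
Definition ecball (R : realType) (c : pt R) (d : R) : set (pt R) :=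
  [set x | edist c x <= d / 2].

Definition outer_diam (R : realType) (S : set (pt R)) : R :=
  inf [set d | exists c, S `<=` ecball c d].

Definition inner_diam (R : realType) (S : set (pt R)) : R :=
  sup [set d | 0 <= d /\ exists c, ecball c d `<=` S].

(* Convex hull of the points v i, i \in A; it is empty when A is. *)
Definition hull_on (R : realType) (n : nat) (v : 'I_n -> pt R)
    (A : {set 'I_n}) : set (pt R) :=
  [set x | exists w : 'I_n -> R,
     [/\ forall i, 0 <= w i, forall i, i \notin A -> w i = 0,
         \sum_i w i = 1 & x = \sum_i w i *: v i]].

Definition hull (R : realType) (n : nat) (v : 'I_n -> pt R) : set (pt R) :=
  hull_on v [set: 'I_n]%SET.

Definition aff_indep (R : realType) (n : nat) (v : 'I_n -> pt R) : Prop :=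
  forall w : 'I_n -> R, \sum_i w i = 0 -> \sum_i w i *: v i = 0 ->
  forall i, w i = 0.

Definition tetrahedron (R : realType) (S : set (pt R)) : Prop :=
  exists2 v : 'I_4 -> pt R, aff_indep v & S = hull v.

(* A vertex, edge, facet, S itself, or the empty set. *)
Definition face_of (R : realType) (F S : set (pt R)) : Prop :=
  exists v : 'I_4 -> pt R, [/\ aff_indep v, S = hull v &
    exists A : {set 'I_4}, F = hull_on v A].

Definition domain (R : realType) (Omega : set (pt R)) : Prop :=
  [/\ open Omega, connected Omega & Omega !=set0].

(* The last clause is local finiteness; it is automatic for finite T, and T is
   finite whenever Omega is bounded. *)
Definition triangulation (R : realType) (Omega : set (pt R))
    (T : set (set (pt R))) : Prop :=
  [/\ forall S, T S -> tetrahedron S,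
      closure Omega = \bigcup_(S in T) S,
      forall S S', T S -> T S' -> face_of (S `&` S') S /\ face_of (S `&` S') S' &
      forall x : pt R, exists2 U, nbhs x U & finite_set [set S | T S /\ S `&` U !=set0]].

Definition regular_family (R : realType) (Omega : set (pt R)) (alpha : R)
    (T : R -> set (set (pt R))) : Prop :=
  (forall h, 0 < h -> triangulation Omega (T h)) /\
  (ereal_sup [set (outer_diam S / inner_diam S)%:E
             | S in \bigcup_(h in [set h : R | (0 < h)%R]) T h] <= alpha%:E)%E.

Definition ediam (R : realType) (A : set (pt R)) : \bar R :=
  ereal_sup ([set 0%E] `|` [set (edist p.1 p.2)%:E | p in A `*` A]).

(* Two-dimensional Hausdorff (outer) measure, normalised so that it is the area
   on planar sets. *)
Definition meas2 (R : realType) (A : set (pt R)) : \bar R :=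
  ((pi / 4)%:E * ereal_sup [set ereal_inf
     [set \sum_(0 <= n <oo) ediam (U n) ^+ 2 | U in
        [set U : nat -> set (pt R) | A `<=` \bigcup_n U n /\
           forall n, (ediam (U n) <= delta%:E)%E]]
   | delta in [set delta : R | (0 < delta)%R]])%E.

(* C^{0,1} surface without boundary: a closed set which near each of its points
   is, in suitable orthonormal coordinates (the columns of Q), the graph of a
   Lipschitz function of the first two coordinates.  A Lipschitz function given
   near one point only extends to the whole plane, so g may be taken global. *)
Definition lipschitz_surface (R : realType) (G : set (pt R)) : Prop :=
  closed G /\
  forall p, G p -> exists (Q : 'M[R]_3) (g : 'rV[R]_2 -> R),
    [/\ Q *m Q^T = 1%:M, lipschitz g &
        \forall x \near p,
          G x <-> (x *m Q) 0 ord_max = g (lsubmx (x *m Q : 'rV[R]_(2 + 1)))].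

Definition planar (R : realType) (A : set (pt R)) : Prop :=
  exists (n : pt R) (c : R), n != 0 /\ A `<=` [set x | dotp n x = c].

Definition consistent (R : realType) (T : set (set (pt R)))
    (G : set (pt R)) : Prop :=
  forall S, T S -> (0 < meas2 (S `&` G))%E -> planar (S `&` G).

Definition angle (R : realType) (a b c : pt R) : R :=
  acos (dotp (a - b) (c - b) / (enorm (a - b) * enorm (c - b))).

(* Inner angle at vertex i of the convex polygon with vertices p 0, p 1, ... in
   cyclic order; i - 1 and i + 1 are taken modulo the number of vertices. *)
Definition inner_angle (R : realType) (n : nat) (p : 'I_n.+2 -> pt R)
    (i : 'I_n.+2) : R :=
  angle (p (i - 1)) (p i) (p (i + 1)).

(* Nondegenerate convex quadrilateral, vertices in cyclic order: the diagonals
   cross at a point interior to both. *)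
Definition convex_quad (R : realType) (q : 'I_4 -> pt R) : Prop :=
  aff_indep (tnth [tuple q 0; q 1; q 2]) /\
  exists s t : R, [/\ 0 < s < 1, 0 < t < 1 &
    (1 - s) *: q 0 + s *: q 2 = (1 - t) *: q 1 + t *: q 3].

(* [division E D]: D is the set of triangles (given with an arbitrary numbering
   of their vertices) into which the element E is divided.  If several vertices
   of a quadrilateral have largest inner angle, any of them may be used.  A set
   that is neither a triangle nor a quadrilateral yields no triangle, so that
   [division] does not presuppose the shape of E. *)
Inductive division (R : realType) (E : set (pt R)) :
    set ('I_3 -> pt R) -> Prop :=
| division_triangle (t : 'I_3 -> pt R) :
    aff_indep t -> E = hull t -> division E [set t]
| division_quad (q : 'I_4 -> pt R) (k : 'I_4) (t1 t2 : 'I_3 -> pt R) :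
    convex_quad q -> E = hull q ->
    (forall j, inner_angle q j <= inner_angle q k) ->
    range t1 = [set q k; q (k + 1); q (k + 2)] ->
    range t2 = [set q k; q (k + 2); q (k + 3)] ->
    division E [set t1; t2]
| division_other :
    ~ (exists2 t : 'I_3 -> pt R, aff_indep t & E = hull t) ->
    ~ (exists2 q : 'I_4 -> pt R, convex_quad q & E = hull q) ->
    division E set0.

Definition surface_triangulation (R : realType) (T : set (set (pt R)))
    (G : set (pt R)) (F : set ('I_3 -> pt R)) : Prop :=
  exists D : set (pt R) -> set ('I_3 -> pt R),
    (forall S, T S -> (0 < meas2 (S `&` G))%E -> division (S `&` G) (D S)) /\
    F = \bigcup_(S in [set S | T S /\ (0 < meas2 (S `&` G))%E]) D S.

(* Main.v *)
(* An element is the full section of a tetrahedron S by the plane that contains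
   it.  Near a point of the relative interior of the section, the surface lies in
   the tetrahedra through that point; these contain the section, so that the
   surface lies in the same plane and, being a graph, fills it.  Hence the surface
   is relatively open and closed in the interior of the section.

   A section is a triangle with vertices on three edges from a common vertex of S,
   or a quadrilateral with vertices on four edges forming a cycle.  Regularity
   bounds the gradients of the barycentric coordinates by alpha / diam S.  For a
   triangle, and for a side and a diagonal of a quadrilateral, a small integer
   combination of these gradients has scalar product at least 1 / diam S with the
   unit vectors of both legs of the angle, which keeps the legs from being nearly
   opposite.  Two adjacent angles of a quadrilateral cannot both be nearly flat, so
   the neighbours of the largest angle, which are not cut, are bounded as well. *)

Require Import Defs.
From mathcomp Require Import all_boot all_order all_algebra.
From mathcomp Require Import all_classical all_reals all_analysis.
From mathcomp Require Import ring lra zify.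
Set Implicit Arguments.
Unset Strict Implicit.
Unset Printing Implicit Defensive.
Import Order.TTheory GRing.Theory Num.Theory.
Import numFieldNormedType.Exports.
Local Open Scope classical_set_scope.
Local Open Scope ring_scope.

(** * Euclidean geometry *)

Section Euclid.
Variable R : realType.
Implicit Types (u v w x y z : pt R) (a b k : R).

(** Two obstacles shape the proof. A division describes an element only as a point set with some
    list of vertices, whereas the plane section is computed with a list of its own. The equality of
    two convex hulls is the only link, so vertices are matched as extreme points, and for a
    quadrilateral the cyclic order is recovered from the crossing of the diagonals. Consistency, on
    the other hand, speaks only of intersections of positive measure. Measure therefore enters
    through two facts: a null set cannot cover a neighbourhood in a Lipschitz graph, and a bounded
    set that is not null contains three noncollinear points, which determine its plane. *)

Lemma dotpC u v : dotp u v = dotp v u.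
Proof. by apply: eq_bigr => i _; rewrite mulrC. Qed.

Lemma dotpDl u v w : dotp (u + v) w = dotp u w + dotp v w.
Proof.
by rewrite /dotp -big_split /=; apply: eq_bigr => i _; rewrite mxE mulrDl.
Qed.

Lemma dotpZl k u v : dotp (k *: u) v = k * dotp u v.
Proof. by rewrite /dotp mulr_sumr; apply: eq_bigr => i _; rewrite mxE mulrA. Qed.

Lemma dotpNl u v : dotp (- u) v = - dotp u v.
Proof. by rewrite -scaleN1r dotpZl mulN1r. Qed.

Lemma dotpBl u v w : dotp (u - v) w = dotp u w - dotp v w.
Proof. by rewrite dotpDl dotpNl. Qed.

Lemma dotpDr u v w : dotp u (v + w) = dotp u v + dotp u w.
Proof. by rewrite dotpC dotpDl !(dotpC u). Qed.

Lemma dotpZr k u v : dotp u (k *: v) = k * dotp u v.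
Proof. by rewrite dotpC dotpZl dotpC. Qed.

Lemma dotpNr u v : dotp u (- v) = - dotp u v.
Proof. by rewrite dotpC dotpNl dotpC. Qed.

Lemma dotpBr u v w : dotp u (v - w) = dotp u v - dotp u w.
Proof. by rewrite dotpDr dotpNr. Qed.

Lemma dotp0l u : dotp 0 u = 0.
Proof. by rewrite -(scale0r 0) dotpZl mul0r. Qed.

Lemma dotp0r u : dotp u 0 = 0.
Proof. by rewrite dotpC dotp0l. Qed.

Lemma dotp_sumr (I : finType) u (F : I -> pt R) :
  dotp u (\sum_i F i) = \sum_i dotp u (F i).
Proof.
elim/big_rec2: _ => [|i y1 y2 _ <-]; first by rewrite dotp0r.
by rewrite dotpDr.
Qed.

Definition dotpE := (dotpDl, dotpDr, dotpBl, dotpBr, dotpZl, dotpZr,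
  dotpNl, dotpNr, dotp0l, dotp0r).

Lemma dotp_ge0 u : 0 <= dotp u u.
Proof. by apply: sumr_ge0 => i _; rewrite -expr2 sqr_ge0. Qed.

Lemma dotp_eq0 u : dotp u u = 0 -> u = 0.
Proof.
move=> /eqP; rewrite psumr_eq0 => [/allP h|i _]; last by rewrite -expr2 sqr_ge0.
apply/rowP => i; have := h i; rewrite mem_index_enum => /(_ isT).
by rewrite -expr2 sqrf_eq0 mxE => /eqP.
Qed.

Lemma enorm_ge0 u : 0 <= enorm u.
Proof. exact: sqrtr_ge0. Qed.

Lemma enorm_sqr u : enorm u ^+ 2 = dotp u u.
Proof. by rewrite sqr_sqrtr // dotp_ge0. Qed.

Lemma enorm0 : enorm (0 : pt R) = 0.
Proof. by rewrite /enorm dotp0l sqrtr0. Qed.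

Lemma enorm_eq0 u : (enorm u == 0) = (u == 0).
Proof.
apply/eqP/eqP => [e|->]; last exact: enorm0.
by apply: dotp_eq0; rewrite -enorm_sqr e expr0n.
Qed.

Lemma enorm_gt0 u : (0 < enorm u) = (u != 0).
Proof. by rewrite lt_def enorm_ge0 andbT enorm_eq0. Qed.

Lemma enormZ k u : enorm (k *: u) = `|k| * enorm u.
Proof.
rewrite /enorm dotpZl dotpZr mulrA -expr2 sqrtrM ?sqr_ge0 //.
by rewrite sqrtr_sqr.
Qed.

Lemma enormN u : enorm (- u) = enorm u.
Proof. by rewrite /enorm dotpNl dotpNr opprK. Qed.

Lemma edistC x y : enorm (x - y) = enorm (y - x).
Proof. by rewrite -enormN opprB. Qed.

Lemma cauchy_schwarz u v : dotp u v <= enorm u * enorm v.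
Proof.
have [->|u0] := eqVneq u 0; first by rewrite dotp0l enorm0 mul0r.
have [->|v0] := eqVneq v 0; first by rewrite dotp0r enorm0 mulr0.
have pu : 0 < enorm u by rewrite enorm_gt0.
have pv : 0 < enorm v by rewrite enorm_gt0.
have := dotp_ge0 (enorm v *: u - enorm u *: v).
rewrite !dotpE (dotpC v u) -!enorm_sqr => h.
have : 0 <= (2 * (enorm u * enorm v)) * (enorm u * enorm v - dotp u v).
  by apply: le_trans h _; rewrite le_eqVlt; apply/orP; left; apply/eqP; ring.
rewrite pmulr_rge0 ?subr_ge0 //.
by rewrite !mulr_gt0.
Qed.

Lemma cauchy_schwarz_abs u v : `|dotp u v| <= enorm u * enorm v.
Proof.
rewrite ler_norml cauchy_schwarz andbT lerNl -dotpNl.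
by rewrite -(enormN u) cauchy_schwarz.
Qed.

Lemma enormD u v : enorm (u + v) <= enorm u + enorm v.
Proof.
rewrite -(@ler_pXn2r _ 2) ?nnegrE ?enorm_ge0 ?addr_ge0 ?enorm_ge0 //.
rewrite enorm_sqr !dotpE (dotpC v u) sqrrD !enorm_sqr.
have := cauchy_schwarz u v; lra.
Qed.

Lemma enormB u v : enorm (u - v) <= enorm u + enorm v.
Proof. by rewrite -(enormN v) enormD. Qed.

Lemma edist_triangle x y z : enorm (x - z) <= enorm (x - y) + enorm (y - z).
Proof. by apply: le_trans (enormD _ _); rewrite addrA subrK. Qed.

Lemma coord_le_enorm u (i : 'I_3) : `|u 0 i| <= enorm u.
Proof.
rewrite -(@ler_pXn2r _ 2) ?nnegrE ?enorm_ge0 // enorm_sqr real_normK ?num_real //.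
rewrite /dotp (bigD1 i) //= expr2 lerDl sumr_ge0 // => j _.
by rewrite -expr2 sqr_ge0.
Qed.

Lemma enorm_le_coord u k : (forall i, `|u 0 i| <= k) -> enorm u <= 3 * k.
Proof.
move=> h; have k0 : 0 <= k := le_trans (normr_ge0 _) (h 0).
rewrite -(@ler_pXn2r _ 2) ?nnegrE ?enorm_ge0 ?mulr_ge0 // enorm_sqr.
apply: (@le_trans _ _ (\sum_(i < 3) k ^+ 2)).
  apply: ler_sum => i _; rewrite -expr2 -real_normK ?num_real //.
  by rewrite ler_pXn2r ?nnegrE.
rewrite sumr_const card_ord -mulr_natl; nra.
Qed.

(* Unit vectors u, v with g.u, g.v >= 1 satisfy 2 <= g.(u + v) <= K |u + v|,
   which bounds |u + v|^2 = 2 + 2 u.v from below. *)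
Lemma cos_lower_bound (g u v : pt R) (K : R) : 0 < K ->
  enorm g <= K -> enorm u <= dotp g u -> enorm v <= dotp g v ->
  (2 / K ^+ 2 - 1) * (enorm u * enorm v) <= dotp u v.
Proof.
move=> K0 gK gu gv.
have [->|u0] := eqVneq u 0; first by rewrite dotp0l enorm0 mul0r mulr0.
have [->|v0] := eqVneq v 0; first by rewrite dotp0r enorm0 !mulr0.
have pu : 0 < enorm u by rewrite enorm_gt0.
have pv : 0 < enorm v by rewrite enorm_gt0.
set w := enorm v *: u + enorm u *: v.
have h1 : 2 * (enorm u * enorm v) <= dotp g w.
  by rewrite /w !dotpE; nra.
have h2 : 2 * (enorm u * enorm v) <= K * enorm w.
  by apply: le_trans h1 (le_trans (cauchy_schwarz _ _) _); rewrite ler_wpM2r ?enorm_ge0.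
have h3 : (2 * (enorm u * enorm v)) ^+ 2 <= K ^+ 2 * dotp w w.
  rewrite -enorm_sqr -exprMn ler_pXn2r ?nnegrE ?mulr_ge0 ?enorm_ge0 //.
  exact: ltW.
have e : dotp w w = 2 * (enorm u * enorm v) * (enorm u * enorm v + dotp u v).
  by rewrite /w !dotpE (dotpC v u) -!enorm_sqr; ring.
move: h3; rewrite e => h3.
have h4 : 2 * (enorm u * enorm v) <= K ^+ 2 * (enorm u * enorm v + dotp u v).
  by rewrite -(@ler_pM2l _ (2 * (enorm u * enorm v))) ?mulr_gt0 //; nra.
have K2 : 0 < K ^+ 2 by rewrite exprn_gt0.
rewrite mulrBl mul1r lerBlDr mulrAC ler_pdivrMr // [dotp u v + _]addrC mulrC.
nra.
Qed.

(** The factor 8 makes [2 + 2 * cosmin a] equal to [(1 / (2 * a)) ^+ 2]: two unit vectors with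
    cosine below [cosmin a] have a sum shorter than [1 / (2 * a)]. Two such sums together stay below
    [1 / a], which contradicts a functional of norm at most [2 * a] that is at most -1 on two unit
    vectors. *)
Definition cosmin (a : R) : R := 1 / (8 * a ^+ 2) - 1.

Lemma cosmin_bounds a : 1 <= a -> -1 < cosmin a <= 0.
Proof.
move=> a1; have a2 : 1 <= a ^+ 2 by rewrite expr_ge1 // (le_trans _ a1).
rewrite /cosmin; apply/andP; split.
  by rewrite ltrBrDr addNr divr_gt0 //; lra.
by rewrite subr_le0 ler_pdivrMr; lra.
Qed.

(** The norm bound [3 * a] gives the cosine bound [2 / (9 * a ^+ 2) - 1], here weakened to the
    common constant. *)
Lemma cos_lower_bound3 (g u v : pt R) a : 1 <= a ->
  enorm g <= 3 * a -> enorm u <= dotp g u -> enorm v <= dotp g v ->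
  cosmin a * (enorm u * enorm v) <= dotp u v.
Proof.
move=> a1 ga gu gv; apply: le_trans (cos_lower_bound _ ga gu gv); last lra.
apply: ler_wpM2r; first by rewrite mulr_ge0 ?enorm_ge0.
have a2 : 1 <= a ^+ 2 by rewrite expr_ge1 // (le_trans _ a1).
rewrite /cosmin lerD2r exprMn ler_pdivrMr; last lra.
rewrite mulrAC ler_pdivlMr; nra.
Qed.

(* If both angles were nearly flat, the unit vectors of u and v would be nearly
   opposite, whereas g is at most -1 on both. *)
Lemma cos_lower_bound_adjacent (g u v w : pt R) a : 1 <= a ->
  enorm g <= 2 * a -> enorm u <= - dotp g u -> enorm v <= - dotp g v ->
  cosmin a * (enorm u * enorm w) <= dotp u w \/
  cosmin a * (enorm w * enorm v) <= dotp (- w) v.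
Proof.
move=> a1 ga gu gv.
have [->|u0] := eqVneq u 0; first by left; rewrite dotp0l enorm0 mul0r mulr0.
have [->|v0] := eqVneq v 0; first by right; rewrite dotp0r enorm0 !mulr0.
have [->|w0] := eqVneq w 0; first by left; rewrite dotp0r enorm0 !mulr0.
have pu : 0 < enorm u by rewrite enorm_gt0.
have pv : 0 < enorm v by rewrite enorm_gt0.
have pw : 0 < enorm w by rewrite enorm_gt0.
have a0 : 0 < a by lra.
have [h1|h1] := leP (cosmin a * (enorm u * enorm w)) (dotp u w); first by left.
right; rewrite leNgt; apply/negP => h2.
have [n nP] : exists n, forall x : pt R, n x = (enorm x)^-1 *: x
  by exists (fun x => (enorm x)^-1 *: x).
have nE x : x != 0 -> dotp (n x) (n x) = 1.
  by move=> x0; rewrite !nP !dotpE -enorm_sqr; field; rewrite enorm_eq0.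
have nM x y : dotp (n x) (n y) = dotp x y / (enorm x * enorm y).
  by rewrite !nP !dotpE invfM; ring.
have half (b : R) (x : pt R) : 0 < b -> dotp x x < b ^+ 2 -> enorm x < b.
  move=> b0; rewrite -enorm_sqr ltr_pXn2r ?nnegrE ?enorm_ge0 //; exact: ltW.
have b0 : 0 < 1 / (2 * a) by rewrite divr_gt0 // mulr_gt0.
have bE : 2 + 2 * cosmin a = (1 / (2 * a)) ^+ 2.
  by rewrite /cosmin; field; lra.
have l1 : enorm (n u + n w) < 1 / (2 * a).
  apply: half => //; rewrite !dotpE (dotpC (n w)) !nE // -bE nM.
  have : dotp u w / (enorm u * enorm w) < cosmin a.
    by rewrite ltr_pdivrMr ?mulr_gt0.
  lra.
have l2 : enorm (n v - n w) < 1 / (2 * a).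
  apply: half => //; rewrite !dotpE (dotpC (n v)) !nE // -bE nM.
  have : dotp (- w) v / (enorm w * enorm v) < cosmin a.
    by rewrite ltr_pdivrMr ?mulr_gt0.
  rewrite dotpNl mulNr; lra.
have gn x : x != 0 -> enorm x <= - dotp g x -> dotp g (n x) <= - 1.
  move=> x0 gx; rewrite nP dotpZr mulrC ler_pdivrMr ?enorm_gt0 //; lra.
have l3 := gn _ u0 gu; have l4 := gn _ v0 gv.
have l5 : enorm (n u + n v) < 1 / a.
  have -> : n u + n v = (n u + n w) + (n v - n w) by rewrite addrACA subrr addr0.
  apply: le_lt_trans (enormD _ _) _.
  have -> : 1 / a = 1 / (2 * a) + 1 / (2 * a) by field; lra.
  exact: ltrD.
have l6 : - dotp g (n u + n v) <= 2 * a * enorm (n u + n v).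
  rewrite -dotpNl; apply: le_trans (cauchy_schwarz _ _) _.
  by rewrite enormN ler_wpM2r ?enorm_ge0.
have l7 : a * enorm (n u + n v) < 1 by rewrite mulrC -ltr_pdivlMr.
move: l6; rewrite dotpDr; lra.
Qed.

Lemma angle_cos_bounds (x y z : pt R) :
  -1 <= dotp (x - y) (z - y) / (enorm (x - y) * enorm (z - y)) <= 1.
Proof.
rewrite -ler_norml normrM normfV.
rewrite (ger0_norm (mulr_ge0 (enorm_ge0 (x - y)) (enorm_ge0 (z - y)))).
have := cauchy_schwarz_abs (x - y) (z - y).
have [->|p] := eqVneq (enorm (x - y) * enorm (z - y)) 0.
  by rewrite invr0 mulr0 ler01.
have p' : 0 < enorm (x - y) * enorm (z - y).
  by rewrite lt_def p mulr_ge0 ?enorm_ge0.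
by rewrite ler_pdivrMr // mul1r.
Qed.

Lemma acos_anti (s t : R) : -1 <= s -> s <= t -> t <= 1 -> acos t <= acos s.
Proof.
move=> s1 st t1.
have bs : -1 <= s <= 1 by rewrite s1 (le_trans st).
have bt : -1 <= t <= 1 by rewrite t1 (le_trans s1).
rewrite leNgt; apply/negP => lt_ac.
have it : acos t \in `[0, pi] by rewrite in_itv /= acos_ge0 // acos_lepi.
have js : acos s \in `[0, pi] by rewrite in_itv /= acos_ge0 // acos_lepi.
have := ltr_cos js it; rewrite lt_ac !acosK ?in_itv //= => ts.
by move: st; rewrite leNgt ts.
Qed.

Lemma angle_le_cosmin (x y z : pt R) a : 1 <= a ->
  cosmin a * (enorm (x - y) * enorm (z - y)) <= dotp (x - y) (z - y) ->
  angle x y z <= acos (cosmin a).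
Proof.
move=> a1 h; have /andP[c1 c0] := cosmin_bounds a1.
have /andP[b1 b2] := angle_cos_bounds x y z.
apply: acos_anti => //; first exact: ltW.
(* A leg of length zero makes the quotient 0 by convention, which is admissible because
   [cosmin a <= 0]. *)
have [->|p] := eqVneq (enorm (x - y) * enorm (z - y)) 0.
  by rewrite invr0 mulr0.
have p' : 0 < enorm (x - y) * enorm (z - y).
  by rewrite lt_def p mulr_ge0 ?enorm_ge0.
by rewrite ler_pdivlMr.
Qed.

Lemma angleC (x y z : pt R) : angle x y z = angle z y x.
Proof. by rewrite /angle dotpC mulrC [in RHS]mulrC [enorm (x-y) * _]mulrC. Qed.

(** Angle zero is equality in Cauchy-Schwarz and makes the legs parallel; a functional that vanishes
    on exactly one of them excludes this. A leg of length zero gives the quotient 0, hence again a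
    positive angle. *)
Lemma angle_gt0 (g x y z : pt R) :
  0 < dotp g (x - y) -> dotp g (z - y) = 0 -> 0 < angle x y z.
Proof.
move=> gx gz; apply: acos_gt0.
have /andP[b1 b2] := angle_cos_bounds x y z; rewrite b1 /= lt_neqAle b2 andbT.
apply/eqP => e1.
have [p|p] := eqVneq (enorm (x - y) * enorm (z - y)) 0.
  by move: e1; rewrite p invr0 mulr0 => /esym/eqP; rewrite oner_eq0.
have e : dotp (x - y) (z - y) = enorm (x - y) * enorm (z - y).
  by rewrite -[LHS](divfK p) e1 mul1r.
move: (x - y) (z - y) gx gz p e {e1 b1 b2} => u v gx gz p e.
have : enorm v *: u - enorm u *: v = 0.
  by apply: dotp_eq0; rewrite !dotpE (dotpC v u) e -!enorm_sqr; ring.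
move=> /(congr1 (dotp g)); rewrite !dotpE gz mulr0 subr0 => /eqP.
rewrite mulf_eq0 (gt_eqF gx) orbF => v0.
by move: p; rewrite mulf_eq0 v0 orbT.
Qed.
End Euclid.

(** * Barycentric coordinates *)

Section Barycentric.
Variable R : realType.
Implicit Types (u w x y z n p q : pt R) (v : 'I_4 -> pt R).

Lemma dotp_mulmx n x : dotp n x = (x *m n^T) 0 0.
Proof. by rewrite !mxE; apply: eq_bigr => i _; rewrite !mxE mulrC. Qed.

(** The affine functions are given by gradient and constant term because the estimates concern the
    gradients. *)
Definition bary (g : 'I_4 -> pt R) (c : 'I_4 -> R) (j : 'I_4) x : R :=
  dotp (g j) x + c j.

Definition bary_coords v g c : Prop :=
  (forall i j, bary g c j (v i) = (i == j)%:R) /\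
  (forall x, \sum_j bary g c j x *: v j = x /\ \sum_j bary g c j x = 1).

(** Affine independence makes the matrix with rows [v i], extended by a last entry 1, invertible.
    Column [j] of the inverse holds the gradient and the constant term of coordinate [j]. *)
Lemma bary_coords_exist v : aff_indep v -> exists g c, bary_coords v g c.
Proof.
move=> hv.
pose M : 'M[R]_4 := \matrix_(i < 4) (row_mx (v i) (1%:M : 'M[R]_1) : 'rV_(3 + 1)).
have wM (w : 'rV_4) : w *m M =
    (row_mx (\sum_i w 0 i *: v i) ((\sum_i w 0 i)%:M : 'M[R]_1) : 'rV_(3 + 1)).
  rewrite mulmx_sum_row.
  transitivity (\sum_i (row_mx (w 0 i *: v i) ((w 0 i)%:M : 'M[R]_1) : 'rV_(3 + 1))).
    apply: eq_bigr => i _; rewrite rowK [LHS](@scale_row_mx R 1 3 1).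
    by rewrite scale_scalar_mx mulr1.
  apply/rowP => k; rewrite summxE; case: (@splitP 3 1 k) => l kl.
    have -> : k = lshift 1 l by apply: val_inj.
    rewrite (@row_mxEl R 1 3 1) summxE; apply: eq_bigr => i _.
    by rewrite (@row_mxEl R 1 3 1).
  have -> : k = rshift 3 l by apply: val_inj.
  rewrite (@row_mxEr R 1 3 1) mxE ord1 eqxx mulr1n; apply: eq_bigr => i _.
  by rewrite (@row_mxEr R 1 3 1) mxE eqxx mulr1n.
have Mu : M \in unitmx.
  rewrite -row_free_unit; apply: inj_row_free => w; rewrite wM => e.
  have e1 : \sum_i w 0 i *: v i = 0
    by rewrite -[LHS](@row_mxKl _ 1 3 1 _ ((\sum_i w 0 i)%:M)) e linear0.
  have e2 : \sum_i w 0 i = 0.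
    have := congr1 (@rsubmx _ 1 3 1) e.
    by rewrite row_mxKr linear0 => /matrixP /(_ 0 0); rewrite !mxE mulr1n.
  by apply/rowP => i; rewrite (hv _ e2 e1) mxE.
pose N : 'M[R]_(3 + 1, 4) := invmx M.
exists (fun j => \row_i N (lshift 1 i) j), (fun j => N (rshift 3 ord0) j).
have bE j x : bary (fun j => \row_i N (lshift 1 i) j) (fun j => N (rshift 3 ord0) j) j x
    = ((row_mx x (1%:M : 'M[R]_1) : 'rV_(3 + 1)) *m N) 0 j.
  rewrite /bary [RHS]mxE big_split_ord /= big_ord1 row_mxEr mxE mul1r; congr (_ + _).
  by rewrite /dotp; apply: eq_bigr => i _; rewrite row_mxEl mxE mulrC.
split=> [i j|x].
  rewrite bE; have -> : (row_mx (v i) (1%:M : 'M[R]_1) : 'rV_(3 + 1)) = row i M by rewrite rowK.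
  by rewrite -row_mul mulmxV // !mxE.
have := wM ((row_mx x (1%:M : 'M[R]_1) : 'rV[R]_(3 + 1)) *m N : 'rV[R]_4).
have -> : (row_mx x (1%:M : 'M[R]_1) : 'rV[R]_(3 + 1)) *m N *m M = row_mx x 1%:M.
  by rewrite -mulmxA mulVmx // mulmx1.
move=> e; split.
  have := congr1 (@lsubmx _ 1 3 1) e; rewrite !row_mxKl => h; rewrite [RHS]h.
  by apply: eq_bigr => j _; rewrite bE.
have := congr1 (@rsubmx _ 1 3 1) e.
rewrite !row_mxKr => /matrixP /(_ 0 0); rewrite !mxE !mulr1n => h; rewrite [RHS]h.
by apply: eq_bigr => j _; rewrite bE.
Qed.

Lemma baryB g c j x y : dotp (g j) (x - y) = bary g c j x - bary g c j y.
Proof. by rewrite dotpBr /bary; ring. Qed.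

Lemma bary_sum g c j (I : finType) (s : I -> R) (p : I -> pt R) :
  \sum_i s i = 1 ->
  bary g c j (\sum_i s i *: p i) = \sum_i s i * bary g c j (p i).
Proof.
move=> s1; rewrite /bary dotp_sumr.
under [RHS]eq_bigr do rewrite mulrDr.
rewrite big_split /= -mulr_suml s1 mul1r; congr (_ + _).
by apply: eq_bigr => i _; rewrite dotpZr.
Qed.

Lemma bary_line g c j x y (t : R) :
  bary g c j ((1 - t) *: x + t *: y) = (1 - t) * bary g c j x + t * bary g c j y.
Proof. by rewrite /bary !dotpE; ring. Qed.

Lemma hull_bary v g c x : bary_coords v g c ->
  hull v x <-> forall j, 0 <= bary g c j x.
Proof.
case=> hv hx; split.
  move=> [w [w0 _ w1 ->]] j; rewrite bary_sum //.
  by apply: sumr_ge0 => i _; rewrite hv mulr_ge0.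
move=> h; have [e1 e2] := hx x.
by exists (fun j => bary g c j x); split => // i; rewrite inE.
Qed.

Lemma bary_le1 v g c x j : bary_coords v g c ->
  hull v x -> bary g c j x <= 1.
Proof.
move=> hv /(hull_bary _ hv) h; have [_ <-] := (hv.2 x).
by rewrite (bigD1 j) //= lerDl sumr_ge0.
Qed.

Lemma ord3_cases (P : 'I_3 -> Prop) :
  P (@Ordinal 3 0 isT) -> P (@Ordinal 3 1 isT) -> P (@Ordinal 3 2 isT) ->
  forall i, P i.
Proof.
by move=> h0 h1 h2 [[|[|[|]]] //= i]; rewrite (bool_irrelevance i isT).
Qed.

Lemma dotp3E u w : let o k h := @Ordinal 3 k h in
  dotp u w = u 0 (o 0%N isT) * w 0 (o 0%N isT) + u 0 (o 1%N isT) * w 0 (o 1%N isT)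
    + u 0 (o 2%N isT) * w 0 (o 2%N isT).
Proof.
move=> o; rewrite /dotp 3!big_ord_recl big_ord0 addr0 addrA /=.
by congr (_ * _ + _ * _ + _ * _); congr (_ _ _); apply: val_inj.
Qed.

Definition cross u w : pt R := let o k h := @Ordinal 3 k h in
  \row_i nth 0 [:: u 0 (o 1%N isT) * w 0 (o 2%N isT) - u 0 (o 2%N isT) * w 0 (o 1%N isT);
    u 0 (o 2%N isT) * w 0 (o 0%N isT) - u 0 (o 0%N isT) * w 0 (o 2%N isT);
    u 0 (o 0%N isT) * w 0 (o 1%N isT) - u 0 (o 1%N isT) * w 0 (o 0%N isT)] i.

Lemma cross_cross n u w :
  cross n (cross u w) = dotp n w *: u - dotp n u *: w.
Proof.
by apply/rowP; apply: ord3_cases; rewrite !dotp3E !mxE /=; ring.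
Qed.

Lemma cross_eq0 u w : w != 0 -> cross u w = 0 -> exists k, u = k *: w.
Proof.
move=> w0 e; exists (dotp w u / dotp w w).
have ww : dotp w w != 0 by rewrite -enorm_sqr sqrf_eq0 enorm_eq0.
have := cross_cross w u w; rewrite e.
have -> : cross w 0 = 0 by apply/rowP; apply: ord3_cases; rewrite !mxE /=; ring.
move=> /esym/eqP; rewrite subr_eq0 => /eqP h.
by rewrite mulrC -scalerA -h scalerA mulVf // scale1r.
Qed.

(* n and n' are both orthogonal to u and w, hence parallel to their cross product. *)
Lemma plane_subset (n n' p q z : pt R) (c c' : R) :
  n != 0 ->
  dotp n p = c -> dotp n q = c -> dotp n z = c ->
  dotp n' p = c' -> dotp n' q = c' -> dotp n' z = c' ->
  q != p -> ~ (exists t, z - p = t *: (q - p)) ->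
  forall x, dotp n x = c -> dotp n' x = c'.
Proof.
move=> n0 np nq nz np' nq' nz' qp ncol x nx.
have qp0 : q - p != 0 by rewrite subr_eq0.
set m := cross (z - p) (q - p).
have m0 : m != 0 by apply/eqP => /(cross_eq0 qp0).
have ortho k : dotp k (q - p) = 0 -> dotp k (z - p) = 0 -> exists s, k = s *: m.
  move=> h1 h2; apply: cross_eq0 => //.
  by rewrite cross_cross h1 h2 !scale0r subr0.
have [s es] : exists s, n = s *: m.
  by apply: ortho; rewrite dotpBr np ?nq ?nz subrr.
have [s' es'] : exists s, n' = s *: m.
  by apply: ortho; rewrite dotpBr np' ?nq' ?nz' subrr.
have s0 : s != 0 by apply: contra_neq n0 => s0; rewrite es s0 scale0r.
have : dotp n (x - p) = 0 by rewrite dotpBr nx np subrr.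
rewrite es dotpZl => /eqP; rewrite mulf_eq0 (negbTE s0) /= => /eqP mx.
have : dotp n' (x - p) = 0 by rewrite es' dotpZl mx mulr0.
by move=> /eqP; rewrite dotpBr np' subr_eq0 => /eqP.
Qed.

Lemma gradient_neq0 v g c j : bary_coords v g c -> g j != 0.
Proof.
move=> [hv _]; apply/eqP => g0.
have [k kj] : exists k : 'I_4, k != j.
  by exists (j + 1); rewrite -subr_eq0 addrAC subrr add0r.
have := hv j j; have := hv k j; rewrite /bary g0 !dotp0l eqxx (negbTE kj) => -> /eqP.
by rewrite eq_sym oner_eq0.
Qed.

(** Along the diameter in the direction of the gradient the coordinate grows by [enorm (g j) * d],
    while it stays between 0 and 1 on the tetrahedron. *)
Lemma ecball_sub_gradient v g c j z (d : R) : bary_coords v g c -> 0 <= d ->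
  ecball z d `<=` hull v -> enorm (g j) * d <= 1.
Proof.
move=> hv d0 hz; have gp : 0 < enorm (g j) by rewrite enorm_gt0 (gradient_neq0 _ hv).
pose e := (d / 2 / enorm (g j)) *: g j.
have ne : enorm e = d / 2.
  rewrite /e enormZ ger0_norm ?mulr_ge0 ?invr_ge0 ?enorm_ge0 //.
  by rewrite divfK // gt_eqF.
have b1 : hull v (z + e).
  apply: hz; change (enorm (z - (z + e)) <= d / 2).
  by rewrite edistC addrAC subrr add0r ne.
have b2 : hull v (z - e).
  apply: hz; change (enorm (z - (z - e)) <= d / 2).
  by rewrite opprB addrC subrK ne.
have h1 := bary_le1 j hv b1.
have h2 := (hull_bary _ hv).1 b2 j.
have : dotp (g j) (z + e - (z - e)) <= 1 by rewrite (baryB g c); lra.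
have -> : z + e - (z - e) = e + e by apply/rowP => k; rewrite !mxE; ring.
rewrite dotpDr {1 2}/e !dotpZr -!enorm_sqr.
have -> : d / 2 / enorm (g j) * enorm (g j) ^+ 2 = d / 2 * enorm (g j) by field; lra.
lra.
Qed.

Lemma edist_outer_diam v x y : hull v x -> hull v y -> enorm (x - y) <= outer_diam (hull v).
Proof.
move=> hx hy; apply: lb_le_inf; last first.
  move=> d [z hz]; have := edist_triangle x z y.
  have h1 : enorm (z - x) <= d / 2 := hz _ hx.
  have h2 : enorm (z - y) <= d / 2 := hz _ hy.
  rewrite (edistC x z); lra.
(* Some enclosing ball must exist for the infimum to be meaningful; the one around the origin with
   radius [M] will do. *)
pose M := \sum_i enorm (v i).
exists (2 * M), 0 => z [w [w0 _ w1 ->]]; change (enorm (0 - \sum_i w i *: v i) <= 2 * M / 2).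
rewrite sub0r enormN.
have -> : 2 * M / 2 = M by field.
have h (s : seq 'I_4) : enorm (\sum_(i <- s) w i *: v i) <= \sum_(i <- s) enorm (v i).
  elim: s => [|i s IH]; first by rewrite !big_nil enorm0.
  rewrite !big_cons; apply: le_trans (enormD _ _) _; apply: lerD => //.
  rewrite enormZ ger0_norm // ler_piMl ?enorm_ge0 //.
  by rewrite -w1 (bigD1 i) //= lerDl sumr_ge0.
exact: h.
Qed.

Lemma hull_vertex (n : nat) (p : 'I_n -> pt R) i : hull p (p i).
Proof.
exists (fun j => (j == i)%:R); split => [j|j|| ].
- by rewrite ler0n.
- by rewrite inE.
- by rewrite (bigD1 i) //= eqxx big1 ?addr0 // => j /negbTE ->.
- rewrite (bigD1 i) //= eqxx scale1r big1 ?addr0 // => j /negbTE ->.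
  by rewrite scale0r.
Qed.

(** The centre is the centroid, where all coordinates equal 1/4. Within distance [4^-1 / M] none of
    them drops below 0, as [M] bounds all gradients. *)
Lemma inner_ball v : aff_indep v -> exists z (d : R), 0 < d /\ ecball z d `<=` hull v.
Proof.
move=> /bary_coords_exist [g [c hv]].
pose M := \sum_j enorm (g j).
have gM j : enorm (g j) <= M.
  by rewrite /M (bigD1 j) //= lerDl sumr_ge0 // => i _; rewrite enorm_ge0.
have M0 : 0 < M by apply: lt_le_trans (gM 0); rewrite enorm_gt0 (gradient_neq0 _ hv).
exists (\sum_i 4^-1 *: v i), (2 * (4^-1 / M)).
split; first by rewrite !mulr_gt0 ?invr_gt0.
move=> x h; apply/(hull_bary _ hv) => j.
have b0 : bary g c j (\sum_i 4^-1 *: v i) = 4^-1.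
  have s1 : \sum_(i < 4) (4^-1 : R) = 1.
    by rewrite sumr_const card_ord -[LHS]mulr_natr mulVf ?pnatr_eq0.
  rewrite (bary_sum _ _ _ _ s1).
  rewrite (bigD1 j) //= hv.1 eqxx mulr1 big1 ?addr0 // => i /negbTE ij.
  by rewrite hv.1 ij mulr0.
have := baryB g c j x (\sum_i 4^-1 *: v i); rewrite b0 => e.
have := cauchy_schwarz_abs (g j) (x - \sum_i 4^-1 *: v i).
rewrite e ler_norml => /andP[h1 _].
have h2 : enorm (g j) * enorm (x - \sum_i 4^-1 *: v i) <= 4^-1.
  apply: (@le_trans _ _ (M * (2 * (4^-1 / M) / 2))).
    rewrite ler_pM ?enorm_ge0 //; rewrite edistC; exact: h.
  rewrite le_eqVlt; apply/orP; left; apply/eqP; field; exact: lt0r_neq0.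
lra.
Qed.

Lemma gradient_bound v g c (a : R) j : aff_indep v -> bary_coords v g c ->
  outer_diam (hull v) / inner_diam (hull v) <= a ->
  enorm (g j) * outer_diam (hull v) <= a.
Proof.
move=> iv hv h.
have gp : 0 < enorm (g j) by rewrite enorm_gt0 (gradient_neq0 _ hv).
have [z [d [d0 zd]]] := inner_ball iv.
set D := [set d | 0 <= d /\ exists c, ecball c d `<=` hull v].
have Dd : D d by split; [exact: ltW | exists z].
have ubD : ubound D (enorm (g j))^-1.
  move=> e [e0 [y hy]].
  by rewrite -[leLHS](mulKf (lt0r_neq0 gp)) ler_piMr ?invr_ge0 ?enorm_ge0 //
    (ecball_sub_gradient _ hv e0 hy).
(* With inner diameter 0 the quotient would be 0 by convention and would bound nothing. *)
have i0 : 0 < inner_diam (hull v).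
  by apply: lt_le_trans d0 _; apply: ub_le_sup => //; exists (enorm (g j))^-1.
have i1 : inner_diam (hull v) <= (enorm (g j))^-1.
  by apply: ge_sup => //; exists d.
move: h; rewrite ler_pdivrMr // => h.
have o0 : 0 <= outer_diam (hull v).
  apply: le_trans (edist_outer_diam (hull_vertex v 0) (hull_vertex v 1)).
  exact: enorm_ge0.
have a0 : 0 <= a by rewrite -(pmulr_lge0 _ i0) (le_trans o0).
apply: (@le_trans _ _ (enorm (g j) * (a * (enorm (g j))^-1))).
  by rewrite ler_wpM2l ?enorm_ge0 // (le_trans h) // ler_wpM2l.
by rewrite mulrCA divff ?mulr1 // gt_eqF.
Qed.
End Barycentric.

(** * Plane sections of a tetrahedron *)

Lemma ord4_cases (P : 'I_4 -> Prop) : P 0 -> P 1 -> P 2 -> P 3 -> forall i, P i.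
Proof.
move=> h0 h1 h2 h3 [[|[|[|[|]]]] //= i].
- by have -> : Ordinal i = 0 by apply: val_inj.
- by have -> : Ordinal i = 1 by apply: val_inj.
- by have -> : Ordinal i = 2 by apply: val_inj.
- by have -> : Ordinal i = 3 by apply: val_inj.
Qed.

Lemma sum_ord4 (V : zmodType) (F : 'I_4 -> V) :
  \sum_i F i = F 0 + F 1 + F 2 + F 3.
Proof.
rewrite 4!big_ord_recl big_ord0 addr0 !addrA /=.
by congr (F _ + F _ + F _ + F _); apply: val_inj.
Qed.

Lemma sum_ord3 (V : zmodType) (F : 'I_3 -> V) :
  \sum_i F i = F 0 + F 1 + F 2.
Proof.
rewrite 3!big_ord_recl big_ord0 addr0 !addrA /=.
by congr (F _ + F _ + F _); apply: val_inj.
Qed.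

Lemma ord4_add : [/\ 0 + 1 = 1 :> 'I_4, 1 + 1 = 2 :> 'I_4, 2 + 1 = 3 :> 'I_4 & 3 + 1 = 0 :> 'I_4].
Proof. by split; apply: val_inj. Qed.

Section Sections.
Variable R : realType.
Implicit Types (x y z n : pt R) (v q : 'I_4 -> pt R) (t : 'I_3 -> pt R) (d : R).

(** * Convex hulls and their extreme points *)

Lemma hull_comb (m : nat) (p : 'I_m -> pt R) (w : 'I_m -> R) :
  (forall i, 0 <= w i) -> \sum_i w i = 1 -> hull p (\sum_i w i *: p i).
Proof. by move=> w0 w1; exists w; split => // i; rewrite inE. Qed.

Lemma hullW (m : nat) (p : 'I_m -> pt R) x : hull p x ->
  exists w, [/\ forall i, 0 <= w i, \sum_i w i = 1 & x = \sum_i w i *: p i].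
Proof. by move=> [w [w0 _ w1 e]]; exists w. Qed.

Lemma hull_sub (m k : nat) (p : 'I_m -> pt R) (q : 'I_k -> pt R) :
  (forall i, hull q (p i)) -> hull p `<=` hull q.
Proof.
move=> h x /hullW[u [u0 u1 ->]].
have [W hW] := choice (fun i => hullW (h i)).
have -> : \sum_i u i *: p i = \sum_j (\sum_i u i * W i j) *: q j.
  under [RHS]eq_bigr do rewrite scaler_suml.
  rewrite exchange_big /=; apply: eq_bigr => i _.
  have [_ _ ->] := hW i; rewrite scaler_sumr; apply: eq_bigr => j _.
  by rewrite scalerA.
apply: hull_comb => [j|].
  by apply: sumr_ge0 => i _; rewrite mulr_ge0 //; have [] := hW i.
rewrite exchange_big /= -[RHS]u1; apply: eq_bigr => i _.
by have [_ w1 _] := hW i; rewrite -mulr_sumr w1 mulr1.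
Qed.

(** Each [p i] is an extreme point of the hull and is listed once. Affine independence would be too
    strong, as it fails for the four vertices of a quadrilateral. *)
Definition cvx_indep (m : nat) (p : 'I_m -> pt R) : Prop :=
  forall i w, (forall j, 0 <= w j) -> \sum_j w j = 1 ->
    p i = \sum_j w j *: p j -> w i = 1.

Lemma cvx_indep_inj (m : nat) (p : 'I_m -> pt R) : cvx_indep p -> injective p.
Proof.
move=> hp i j e; have := hp i (fun l => (l == j)%:R).
case: eqVneq => // ij h; have /eqP : (0 : R) = 1; last by rewrite eq_sym oner_eq0.
apply: h => [l||]; first by rewrite ler0n.
  by rewrite (bigD1 j) //= eqxx big1 ?addr0 // => l /negbTE ->.
rewrite (bigD1 j) //= eqxx scale1r big1 ?addr0 // => l /negbTE ->.
by rewrite scale0r.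
Qed.

(** Write [p i] through the [q j] and each [q j] through the [p l]. Extremality puts total weight 1
    on [p i], so a [q j] that occurs with nonzero weight has weight 1 there and equals [p i]. *)
Lemma hull_extreme (m k : nat) (p : 'I_m -> pt R) (q : 'I_k -> pt R) :
  cvx_indep p -> hull p = hull q -> forall i, exists j, q j = p i.
Proof.
move=> hp e i.
have /hullW[u [u0 u1 pE]] : hull q (p i) by rewrite -e; exact: hull_vertex.
have hq j : hull p (q j) by rewrite e; exact: hull_vertex.
have [W hW] := choice (fun j => hullW (hq j)).
have W1 : \sum_j u j * W j i = 1.
  apply: (hp i (fun l => \sum_j u j * W j l)) => [l||].
  - by apply: sumr_ge0 => j _; rewrite mulr_ge0 //; have [] := hW j.
  - rewrite exchange_big /= -[RHS]u1; apply: eq_bigr => j _.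
    by have [_ w1 _] := hW j; rewrite -mulr_sumr w1 mulr1.
  - under eq_bigr do rewrite scaler_suml.
    rewrite exchange_big /= pE; apply: eq_bigr => j _.
    have [_ _ ->] := hW j; rewrite scaler_sumr; apply: eq_bigr => l _.
    by rewrite scalerA.
have Wle j l : W j l <= 1.
  by have [w0 <- _] := hW j; rewrite (bigD1 l) //= lerDl sumr_ge0.
have h0 : \sum_j u j * (1 - W j i) = 0.
  under eq_bigr do rewrite mulrBr mulr1.
  by rewrite sumrB u1 W1 subrr.
have [j uj] : exists j, u j != 0.
  apply: contrapT => hn; have : \sum_j u j = 0.
    apply: big1 => j _; apply/eqP; apply: contrapT => /negP uj.
    by apply: hn; exists j.
  by rewrite u1 => /eqP; rewrite oner_eq0.
have Wj : W j i = 1.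
  move/eqP: h0; rewrite psumr_eq0 => [/allP h|l _]; last first.
    by rewrite mulr_ge0 ?subr_ge0.
  have := h j; rewrite mem_index_enum => /(_ isT); rewrite mulf_eq0 (negbTE uj) /=.
  by rewrite subr_eq0 => /eqP.
exists j; have [w0 w1 ->] := hW j.
rewrite (bigD1 i) //= Wj scale1r big1 ?addr0 // => l li.
have : \sum_(l | l != i) W j l = 0.
  by apply: (addrI 1); rewrite addr0 -[in RHS]w1 [in RHS](bigD1 i) //= Wj.
move/eqP; rewrite psumr_eq0 => [/allP h|a _]; last by [].
have := h l; rewrite mem_index_enum li => /(_ isT) /eqP ->.
by rewrite scale0r.
Qed.

Lemma aff_indep_cvx (m : nat) (p : 'I_m -> pt R) : aff_indep p -> cvx_indep p.
Proof.
move=> hp i w w0 w1 e.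
have := hp (fun j => w j - (j == i)%:R) _ _ i.
rewrite eqxx => h; apply/eqP; rewrite -subr_eq0; apply/eqP; apply: h.
  rewrite sumrB w1 (bigD1 i) //= eqxx big1 ?addr0 ?subrr // => j /negbTE ->.
  by [].
under eq_bigr do rewrite scalerBl.
rewrite sumrB -e [X in _ - X](bigD1 i) //= eqxx scale1r big1 ?addr0 ?subrr //.
by move=> j /negbTE ->; rewrite scale0r.
Qed.

Lemma tnth3 (T : Type) (x y z : T) (i : 'I_3) :
  tnth [tuple x; y; z] i = nth x [:: x; y; z] i.
Proof. exact: tnth_nth. Qed.

(** The crossing of the diagonals expresses [q 3] by the affinely independent [q 0], [q 1], [q 2],
    with coefficients of signs plus, minus, plus. Comparing coefficients then fixes the weight at
    [i]. *)
Lemma convex_quad_cvx q : convex_quad q -> cvx_indep q.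
Proof.
move=> [hi [s [t [/andP[s0 s1] /andP[t0 t1] e]]]].
have ind (w0 w1 w2 : R) : w0 + w1 + w2 = 0 ->
    w0 *: q 0 + w1 *: q 1 + w2 *: q 2 = 0 -> [/\ w0 = 0, w1 = 0 & w2 = 0].
  move=> ws wv.
  have := hi (fun i => nth 0 [:: w0; w1; w2] i).
  rewrite !sum_ord3 !tnth3 /= => /(_ ws wv) h.
  by split; [have := h 0|have := h 1|have := h 2].
pose al := (1 - s) / t; pose be := (1 - t) / t; pose ga := s / t.
have al0 : 0 < al by rewrite divr_gt0 ?subr_gt0.
have be0 : 0 < be by rewrite divr_gt0 ?subr_gt0.
have ga0 : 0 < ga by rewrite divr_gt0 ?subr_gt0.
have abg : al + ga = 1 + be by rewrite /al /be /ga; field; exact: lt0r_neq0.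
have q3 : q 3 = al *: q 0 - be *: q 1 + ga *: q 2.
  have : t *: q 3 = (1 - s) *: q 0 + s *: q 2 - (1 - t) *: q 1.
    by rewrite e addrAC subrr add0r.
  move=> /(congr1 (fun x => t^-1 *: x)); rewrite scalerA mulVf ?lt0r_neq0 // scale1r => ->.
  by apply/rowP => k; rewrite /al /be /ga !mxE; field; exact: lt0r_neq0.
move=> i w w0; rewrite !sum_ord4 => w1 e4.
have red (c0 c1 c2 : R) : c0 + c1 + c2 = 1 -> q i = c0 *: q 0 + c1 *: q 1 + c2 *: q 2 ->
  [/\ w 0 + w 3 * al = c0, w 1 - w 3 * be = c1 & w 2 + w 3 * ga = c2].
  move=> cs qi.
  have [] := ind (w 0 + w 3 * al - c0) (w 1 - w 3 * be - c1) (w 2 + w 3 * ga - c2).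
  - have := congr1 (fun r => w 3 * r) abg; rewrite /= !mulrDr; lra.
  - have : q i - q i = 0 by rewrite subrr.
    rewrite {1}e4 qi q3 => h; rewrite -[RHS]h.
    by apply/rowP => k; rewrite !mxE; ring.
  by move=> h1 h2 h3; split; lra.
have := w0 0; have := w0 1; have := w0 2; have := w0 3 => w3p w2p w1p w0p.
elim/ord4_cases: i e4 red => _ red.
- have [] := red 1 0 0 _ _; [lra| |nra].
  by rewrite !scale0r !addr0 scale1r.
- have [] := red 0 1 0 _ _; [lra| |nra].
  by rewrite !scale0r add0r addr0 scale1r.
- have [] := red 0 0 1 _ _; [lra| |nra].
  by rewrite !scale0r !add0r scale1r.
- have [] := red al (- be) ga _ _; [lra| |nra].
  by rewrite q3 scaleNr.
Qed.

(** The value [s i = 1] is allowed because the plane may pass through vertices of the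
    tetrahedron. *)
Definition tri_config v t : Prop :=
  exists (J : 'I_4) (m : 'I_3 -> 'I_4) (s : 'I_3 -> R),
    [/\ injective m, forall i, m i != J, forall i, 0 < s i <= 1 &
        forall i, t i = (1 - s i) *: v J + s i *: v (m i)].

(** Indices are modulo 4, so the edges form a cycle. The inequalities are strict because no vertex
    of the tetrahedron lies on the plane in this case. *)
Definition quad_config v q : Prop :=
  exists (m : 'I_4 -> 'I_4) (s : 'I_4 -> R),
    [/\ injective m, forall i, 0 < s i < 1 &
        forall i, q i = (1 - s i) *: v (m i) + s i *: v (m (i + 1))].

Definition diagonals_cross q : Prop :=
  exists s t : R, [/\ 0 < s < 1, 0 < t < 1 &
    (1 - s) *: q 0 + s *: q 2 = (1 - t) *: q 1 + t *: q 3].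

Definition noncollinear (E : set (pt R)) : Prop :=
  exists x y z, [/\ E x, E y, E z, y != x & ~ (exists k : R, z - x = k *: (y - x))].

Definition slice v n d : set (pt R) := hull v `&` [set x | dotp n x = d].

Lemma sliceN v n d : slice v (- n) (- d) = slice v n d.
Proof.
apply/seteqP; split => x [h e]; split => //; move: e; rewrite /= dotpNl.
  by move=> /oppr_inj.
by move=> ->.
Qed.

Section Slice.
Variables (v : 'I_4 -> pt R) (g : 'I_4 -> pt R) (c : 'I_4 -> R).
Hypothesis hv : bary_coords v g c.

Lemma slice_sum n d x : slice v n d x ->
  \sum_j bary g c j x * (dotp n (v j) - d) = 0.
Proof.
move=> [_ e]; have [e1 e2] := hv.2 x.
under eq_bigr do rewrite mulrBr.
rewrite sumrB -mulr_suml e2 mul1r.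
under eq_bigr do rewrite -dotpZr.
by rewrite -dotp_sumr e1 e subrr.
Qed.

Lemma sub_slice (m : nat) (p : 'I_m -> pt R) n d :
  (forall i, slice v n d (p i)) -> hull p `<=` slice v n d.
Proof.
move=> h x hx; split; first by apply: hull_sub hx => i; have [] := h i.
have [w [w0 w1 ->]] := hullW hx; rewrite /= dotp_sumr.
under eq_bigr => i _ do [rewrite dotpZr; have [_ /= ->] := h i].
by rewrite -mulr_suml w1 mul1r.
Qed.

Lemma hull_segment i j (s : R) : 0 <= s -> s <= 1 ->
  hull v ((1 - s) *: v i + s *: v j).
Proof.
move=> s0 s1; apply/(hull_bary _ hv) => k; rewrite bary_line !hv.1.
by rewrite addr_ge0 // mulr_ge0 ?subr_ge0 ?ler0n.
Qed.

(** The vertices are the zeros of [dotp n - d] on the edges from [J]. A point of the section gets at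
    vertex [i] its coordinate for [lift J i] divided by [s i]; that these weights sum to 1 is the
    equation of the plane. *)
Lemma slice_triangle n d J : 0 < dotp n (v J) - d ->
  (forall k, k != J -> dotp n (v k) - d <= 0) ->
  exists t, tri_config v t /\ slice v n d = hull t.
Proof.
set f := fun k => dotp n (v k) - d => fJ fk.
have vf k : dotp n (v k) = f k + d by rewrite /f subrK.
have fl i : f (lift J i) <= 0 by apply: fk; rewrite eq_sym neq_lift.
pose s (i : 'I_3) := f J / (f J - f (lift J i)).
have s0 i : 0 < s i by rewrite divr_gt0 //; have := fl i; rewrite /f in fJ *; lra.
have den i : f J - f (lift J i) != 0 by apply: lt0r_neq0; have := fl i; rewrite /f in fJ *; lra.
have s1 i : s i <= 1.
  rewrite ler_pdivrMr; first by have := fl i; lra.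
  by have := fl i; rewrite /f in fJ *; lra.
exists (fun i => (1 - s i) *: v J + s i *: v (lift J i)); split.
  exists J, (lift J), s; split=> // [|i|i]; first exact: lift_inj.
    by rewrite eq_sym neq_lift.
  by rewrite s0 s1.
apply/seteqP; split; last first.
  apply: sub_slice => i; split; first by apply: hull_segment => //; exact: ltW.
  by rewrite /= !dotpE !vf /s; field.
move=> x hx; have := slice_sum hx; have [hx1 _] := hx.
have [e1 e2] := hv.2 x.
set la := fun j => bary g c j x.
have la0 j : 0 <= la j by apply: (hull_bary x hv).1.
rewrite (bigD1_ord J) //= => es.
rewrite -/(la _) in es *.
have {}es : la J = \sum_i (la (lift J i) * - f (lift J i) / f J).
  under eq_bigr do rewrite mulrN mulNr.
  rewrite sumrN -mulr_suml.
  have fJ0 : f J != 0 by exact: lt0r_neq0.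
  apply: (mulIf fJ0); rewrite mulNr divfK //.
  by apply/eqP; rewrite -addr_eq0; apply/eqP.
have mu i : la (lift J i) * (f J - f (lift J i)) / f J =
   la (lift J i) + la (lift J i) * - f (lift J i) / f J.
  by field; exact: lt0r_neq0.
exists (fun i => la (lift J i) * (f J - f (lift J i)) / f J).
split => [i|i||].
- have fJ0 : 0 <= f J := ltW fJ.
  rewrite mulr_ge0 ?invr_ge0 // mulr_ge0 // subr_ge0.
  exact: le_trans (fl i) fJ0.
- by rewrite inE.
- under eq_bigr do rewrite mu.
  rewrite big_split /= -es -[RHS]e2 [in RHS](bigD1_ord J) //= addrC.
  by [].
- rewrite -[LHS]e1 (bigD1_ord J) //= -/(la J) es scaler_suml -big_split /=.
  apply: eq_bigr => i _; rewrite scalerDr !scalerA; congr (_ *: _ + _ *: _).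
    by rewrite /s; field; rewrite den lt0r_neq0.
  by rewrite -/(la _) /s; field; rewrite den lt0r_neq0.
Qed.

(* The weight of the vertex on the edge between i and j is the product of the
   coordinates of i and j, suitably normalised: the product coupling of the
   positive and the negative parts. *)
Lemma slice_quad n d (m : 'I_4 -> 'I_4) : injective m ->
  0 < dotp n (v (m 0)) - d -> dotp n (v (m 1)) - d < 0 ->
  0 < dotp n (v (m 2)) - d -> dotp n (v (m 3)) - d < 0 ->
  exists q, [/\ quad_config v q, diagonals_cross q & slice v n d = hull q].
Proof.
move=> im; set f := fun k => dotp n (v (m k)) - d => f0 f1 f2 f3.
have vf k : dotp n (v (m k)) = f k + d by rewrite /f subrK.
rewrite -/(f 0) -/(f 1) -/(f 2) -/(f 3) in f0 f1 f2 f3.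
have [a1 a2 a3 a4] := ord4_add.
pose s i := f i / (f i - f (i + 1)).
have den i : f i - f (i + 1) != 0.
  elim/ord4_cases: i; rewrite ?a1 ?a2 ?a3 ?a4.
  - by apply: lt0r_neq0; lra.
  - by apply: ltr0_neq0; lra.
  - by apply: lt0r_neq0; lra.
  - by apply: ltr0_neq0; lra.
have s01 i : 0 < s i < 1.
  have pos (a b : R) : 0 < a -> b < 0 -> 0 < a / (a - b) < 1.
    move=> a0 b0; have ab : 0 < a - b by lra.
    by rewrite divr_gt0 //= ltr_pdivrMr //; lra.
  have neg (a b : R) : a < 0 -> 0 < b -> 0 < a / (a - b) < 1.
    move=> a0 b0; have -> : a / (a - b) = (- a) / ((- a) - (- b)).
      by rewrite (_ : - a - - b = - (a - b)); [rewrite invrN mulrNN|ring].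
    by apply: pos; lra.
  rewrite /s; elim/ord4_cases: i; rewrite ?a1 ?a2 ?a3 ?a4;
    by [apply: pos|apply: neg].
pose q i := (1 - s i) *: v (m i) + s i *: v (m (i + 1)).
exists q; split; first by exists m, s.
  pose b := - f 1; pose e := - f 3.
  have b0 : 0 < b by rewrite oppr_gt0.
  have e0 : 0 < e by rewrite oppr_gt0.
  pose N := f 0 * f 2 * e + b * f 2 * e + f 0 * b * f 2 + f 0 * b * e.
  have N0 : 0 < N by rewrite !addr_gt0 // !mulr_gt0.
  (* These parameters solve the equations [kA] to [kD], which compare the coefficients of the four
     vertices of the tetrahedron. *)
  exists (f 0 * b * (f 2 + e) / N), (b * f 2 * (f 0 + e) / N).
  have p1 : 0 < f 0 * f 2 * e by rewrite !mulr_gt0.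
  have p2 : 0 < b * f 2 * e by rewrite !mulr_gt0.
  have p3 : 0 < f 0 * b * f 2 by rewrite !mulr_gt0.
  have p4 : 0 < f 0 * b * e by rewrite !mulr_gt0.
  split.
  - by rewrite ltr_pdivlMr // ltr_pdivrMr // /N; apply/andP; split; lra.
  - by rewrite ltr_pdivlMr // ltr_pdivrMr // /N; apply/andP; split; lra.
  - have k1 : f 1 = - b by rewrite opprK.
    have k3 : f 3 = - e by rewrite opprK.
    have Nn := lt0r_neq0 N0.
    have ab : f 0 + b != 0 by apply: lt0r_neq0; lra.
    have bc : b + f 2 != 0 by apply: lt0r_neq0; lra.
    have ce : f 2 + e != 0 by apply: lt0r_neq0; lra.
    have ea : e + f 0 != 0 by apply: lt0r_neq0; lra.
    have r0 : s 0 = f 0 / (f 0 + b) by rewrite /s a1 k1 opprK.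
    have r1 : s 1 = b / (b + f 2).
      by rewrite /s a2 k1 -opprD invrN mulrNN.
    have r2 : s 2 = f 2 / (f 2 + e) by rewrite /s a3 k3 opprK.
    have r3 : s 3 = e / (e + f 0).
      by rewrite /s a4 k3 -opprD invrN mulrNN.
    rewrite /q a1 a2 a3 a4 r0 r1 r2 r3.
    set S := f 0 * b * _ / N; set T := b * f 2 * _ / N.
    have kA : (1 - S) * (1 - f 0 / (f 0 + b)) = T * (e / (e + f 0)).
      by rewrite /S /T /N; field; rewrite -/N Nn ab ea.
    have kB : (1 - S) * (f 0 / (f 0 + b)) = (1 - T) * (1 - b / (b + f 2)).
      by rewrite /S /T /N; field; rewrite -/N Nn ab bc.
    have kC : S * (1 - f 2 / (f 2 + e)) = (1 - T) * (b / (b + f 2)).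
      by rewrite /S /T /N; field; rewrite -/N Nn bc ce.
    have kD : S * (f 2 / (f 2 + e)) = T * (1 - e / (e + f 0)).
      by rewrite /S /T /N; field; rewrite -/N Nn ce ea.
    clearbody S T; rewrite !scalerDr !scalerA kA kB kC kD.
    by rewrite [LHS]addrACA [RHS]addrACA addrC; congr (_ + _); rewrite addrC.
apply/seteqP; split; last first.
  apply: sub_slice => i; split.
    by apply: hull_segment => //; have /andP[] := s01 i; [move=> /ltW|move=> _ /ltW].
  by rewrite /= !dotpE !vf /s; field.
move=> x hx; have := slice_sum hx; have [hx1 _] := hx.
have [e1 e2] := hv.2 x.
pose la k := bary g c (m k) x.
have la0 j : 0 <= la j by apply: (hull_bary x hv).1.
rewrite (reindex_inj im) /= sum_ord4 -/(la _) -/(la _) -/(la 1) -/(la 2) -/(la 3).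
rewrite -/(f 0) -/(f 1) -/(f 2) -/(f 3) -/(la 0) => es.
move: e1 e2; rewrite (reindex_inj im) /= sum_ord4 => e1.
rewrite (reindex_inj im) /= sum_ord4 => e2.
rewrite -/(la 0) -/(la 1) -/(la 2) -/(la 3) in e1 e2.
(* [M] is the mass of the positive part and, by [M'], also of the negative part. It could vanish
   only if all coordinates did. *)
pose M := la 0 * f 0 + la 2 * f 2.
have M' : M = la 1 * (- f 1) + la 3 * (- f 3) by rewrite /M; lra.
have M0 : 0 < M.
  have := la0 0; have := la0 1; have := la0 2; have := la0 3 => l3 l2 l1 l0.
  rewrite lt_def; apply/andP; split; last by rewrite /M addr_ge0 // mulr_ge0 // ltW.
  apply/eqP => Mz.
  have z0 : la 0 = 0 by move: Mz; rewrite /M; nra.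
  have z2 : la 2 = 0 by move: Mz; rewrite /M; nra.
  have z1 : la 1 = 0 by move: Mz; rewrite M'; nra.
  have z3 : la 3 = 0 by move: Mz; rewrite M'; nra.
  by move: e2; rewrite z0 z1 z2 z3; lra.
pose mu (i : 'I_4) := nth 0 [:: la 0 * la 1 * (f 0 - f 1) / M; la 1 * la 2 * (f 2 - f 1) / M;
   la 2 * la 3 * (f 2 - f 3) / M; la 3 * la 0 * (f 0 - f 3) / M] i.
have m0 : mu 0 = la 0 * la 1 * (f 0 - f 1) / M by [].
have m1 : mu 1 = la 1 * la 2 * (f 2 - f 1) / M by [].
have m2 : mu 2 = la 2 * la 3 * (f 2 - f 3) / M by [].
have m3 : mu 3 = la 3 * la 0 * (f 0 - f 3) / M by [].
have Mn := lt0r_neq0 M0.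
have := den 0; have := den 1; have := den 2; have := den 3.
rewrite a1 a2 a3 a4 => d3 d2 d1 d0.
have d1' : f 2 - f 1 != 0 by rewrite -opprB oppr_eq0.
have d3' : f 0 - f 3 != 0 by rewrite -opprB oppr_eq0.
have c0 : mu 0 * (1 - s 0) + mu 3 * s 3 = la 0.
  apply: (mulIf Mn); rewrite [in RHS]M' m0 m3 /s a1 a4; field.
  by rewrite d0 d3 Mn.
have c1 : mu 1 * (1 - s 1) + mu 0 * s 0 = la 1.
  apply: (mulIf Mn); rewrite [in RHS]/M m0 m1 /s a1 a2; field.
  by rewrite d0 d1 Mn.
have c2 : mu 2 * (1 - s 2) + mu 1 * s 1 = la 2.
  apply: (mulIf Mn); rewrite [in RHS]M' m1 m2 /s a2 a3; field.
  by rewrite d1 d2 Mn.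
have c3 : mu 3 * (1 - s 3) + mu 2 * s 2 = la 3.
  apply: (mulIf Mn); rewrite [in RHS]/M m2 m3 /s a3 a4; field.
  by rewrite d2 d3 Mn.
have -> : x = \sum_i mu i *: q i.
  rewrite sum_ord4 /q a1 a2 a3 a4 -e1 -c0 -c1 -c2 -c3.
  by apply/rowP => k; rewrite !mxE; ring.
apply: hull_comb => [i|]; last first.
  by rewrite sum_ord4 -[RHS]e2 -c0 -c1 -c2 -c3; ring.
elim/ord4_cases: i; rewrite ?m0 ?m1 ?m2 ?m3 !mulr_ge0 ?invr_ge0 ?(ltW M0) //; lra.
Qed.
End Slice.
End Sections.

(** * Classification of the sections by the signs at the vertices *)

Section Shape.
Variable R : realType.
Implicit Types (x y z n : pt R) (q : 'I_4 -> pt R) (t : 'I_3 -> pt R) (d : R).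
Variables (v : 'I_4 -> pt R) (g : 'I_4 -> pt R) (c : 'I_4 -> R).
Hypothesis hv : bary_coords v g c.

Lemma sum_ge0_eq0 (I : finType) (F : I -> R) : (forall i, 0 <= F i) ->
  \sum_i F i = 0 -> forall i, F i = 0.
Proof.
move=> F0 /eqP; rewrite psumr_eq0 => [/allP h i|i _]; last exact: F0.
by have := h i; rewrite mem_index_enum => /(_ isT) /eqP.
Qed.

(** With no vertex on the negative side, the section lies in the facet opposite to each vertex on
    the positive side. Two such facets would share three noncollinear points, hence their plane. *)
Lemma slice_two_vertices n d i j : noncollinear (slice v n d) ->
  (forall k, 0 <= dotp n (v k) - d) ->
  0 < dotp n (v i) - d -> 0 < dotp n (v j) - d -> i = j.
Proof.
move=> [x [y [z [hx hy hz yx nc]]]] f0 fi fj.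
have van k : 0 < dotp n (v k) - d ->
    forall u, slice v n d u -> dotp (g k) u = - c k.
  move=> fk u hu.
  have [hu1 _] := hu.
  have p l : 0 <= bary g c l u * (dotp n (v l) - d).
    by rewrite mulr_ge0 //; exact: (hull_bary _ hv).1.
  have /eqP := sum_ge0_eq0 p (slice_sum hv hu) k.
  rewrite mulf_eq0 (gt_eqF fk) orbF /bary => /eqP h; lra.
apply/eqP; apply: contrapT => /negP ij.
have h := plane_subset (gradient_neq0 i hv) (van _ fi _ hx) (van _ fi _ hy)
  (van _ fi _ hz) (van _ fj _ hx) (van _ fj _ hy) (van _ fj _ hz) yx nc.
have e1 := hv.1 j i; have e2 := hv.1 j j.
rewrite /bary eq_sym (negbTE ij) mulr0n in e1; rewrite /bary eqxx mulr1n in e2.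
have e3 : dotp (g i) (v j) = - c i by lra.
have := h _ e3; lra.
Qed.

(** A vertex that alone is strictly positive, or alone strictly negative, gives a triangle.
    Otherwise there are two of each sign, and the order [A], [B], [C], [D] alternates the signs. *)
Lemma slice_shape_pos n d : noncollinear (slice v n d) ->
  (exists i, 0 < dotp n (v i) - d) ->
  (exists t, tri_config v t /\ slice v n d = hull t) \/
  (exists q, [/\ quad_config v q, diagonals_cross q & slice v n d = hull q]).
Proof.
move=> nc [A fA].
have [h|/existsNP[C /not_implyP[CA /negP]]] :=
  pselect (forall k, k != A -> dotp n (v k) - d <= 0).
  by left; exact: slice_triangle hv _ _ _ fA h.
rewrite -ltNge => fC.
have [h|/existsNP[B /negP]] := pselect (forall k, 0 <= dotp n (v k) - d).
  by move: CA; rewrite (slice_two_vertices nc h fC fA) eqxx.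
rewrite -ltNge => fB.
have [h|/existsNP[D /not_implyP[DB /negP]]] :=
  pselect (forall k, k != B -> 0 <= dotp n (v k) - d).
  left; rewrite -sliceN; apply: (slice_triangle hv (J := B)) => [|k kB].
    by rewrite dotpNl; lra.
  by have := h k kB; rewrite dotpNl; lra.
rewrite -ltNge => fD.
right; pose m (i : 'I_4) := nth A [:: A; B; C; D] i.
apply: (slice_quad hv (m := m)) => //.
have dif i j : 0 < dotp n (v i) - d -> dotp n (v j) - d < 0 -> i != j.
  by move=> h1 h2; apply/eqP => e; move: h1 h2; rewrite e; lra.
have us : uniq [:: A; B; C; D].
  have AB := dif A B fA fB; have AD := dif A D fA fD; have CD := dif C D fC fD.
  have BC : B != C by rewrite eq_sym dif.
  have BD : B != D by rewrite eq_sym.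
  have AC : A != C by rewrite eq_sym.
  by rewrite /= !inE !negb_or AB AC AD BC BD CD.
move=> i j /eqP; rewrite /m nth_uniq //; try exact: ltn_ord.
by move=> /eqP /val_inj.
Qed.

Lemma slice_shape n d : n != 0 -> noncollinear (slice v n d) ->
  (exists t, tri_config v t /\ slice v n d = hull t) \/
  (exists q, [/\ quad_config v q, diagonals_cross q & slice v n d = hull q]).
Proof.
move=> n0 nc.
have [h|np] := pselect (exists i, 0 < dotp n (v i) - d); first exact: slice_shape_pos.
have [[i h]|nn] := pselect (exists i, dotp n (v i) - d < 0).
  rewrite -sliceN; apply: slice_shape_pos; first by rewrite sliceN.
  by exists i; rewrite dotpNl; lra.
have f0 i : dotp n (v i) = d.
  apply/eqP; rewrite -subr_eq0 eq_le !leNgt; apply/andP.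
  by split; apply/negP => h; [apply: np|apply: nn]; exists i.
have nd x : dotp n x = d.
  have [e1 e2] := hv.2 x; rewrite -e1 dotp_sumr.
  under eq_bigr do rewrite dotpZr f0.
  by rewrite -mulr_suml e2 mul1r.
(* The plane would be the whole space; its equation at [n] and at 0 gives [dotp n n = 0]. *)
have := nd n; rewrite -(nd 0) dotp0r => /dotp_eq0 n00.
by move: n0; rewrite n00 eqxx.
Qed.

Lemma bary_edge j i k (s : R) :
  bary g c j ((1 - s) *: v i + s *: v k) = (1 - s) * (i == j)%:R + s * (k == j)%:R.
Proof. by rewrite bary_line !hv.1. Qed.

Lemma bary_lin0 j (I : finType) (w : I -> R) (p : I -> pt R) :
  \sum_i w i = 0 -> \sum_i w i *: p i = 0 -> \sum_i w i * bary g c j (p i) = 0.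
Proof.
move=> w0 e; under eq_bigr do rewrite mulrDr.
rewrite big_split /= -mulr_suml w0 mul0r addr0.
under eq_bigr do rewrite -dotpZr.
by rewrite -dotp_sumr e dotp0r.
Qed.

(** The coordinate of [m i] vanishes at every vertex of the triangle except [t i]. *)
Lemma tri_config_indep t : tri_config v t -> aff_indep t.
Proof.
move=> [J [m [s [im mJ s01 tE]]]] w w0 we i.
have := bary_lin0 (m i) w0 we.
rewrite (bigD1 i) //= big1 ?addr0 => [|j ji].
  rewrite tE bary_edge eq_sym (negbTE (mJ i)) eqxx mulr0 add0r mulr1 => /eqP.
  by have /andP[si _] := s01 i; rewrite mulf_eq0 (gt_eqF si) orbF => /eqP.
rewrite tE bary_edge eq_sym (negbTE (mJ i)) (inj_eq im) (negbTE ji).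
by rewrite !mulr0 addr0 mulr0.
Qed.

Lemma ord4_neq : [/\ (0 == 1 :> 'I_4) = false, (0 == 2 :> 'I_4) = false,
   (0 == 3 :> 'I_4) = false & [/\ (1 == 2 :> 'I_4) = false,
   (1 == 3 :> 'I_4) = false & (2 == 3 :> 'I_4) = false]].
Proof. by []. Qed.

(** Among [q 0], [q 1], [q 2] the coordinate of [m 0] is nonzero only at [q 0], and that of [m 3]
    only at [q 2]. *)
Lemma quad_config_convex q :
  quad_config v q -> diagonals_cross q -> convex_quad q.
Proof.
move=> + dc; move=> [m [s [im s01 qE]]].
have [a1 a2 a3 a4] := ord4_add.
have [n01 n02 n03 [n12 n13 n23]] := ord4_neq.
have n10 : (1 == 0 :> 'I_4) = false by [].
have n20 : (2 == 0 :> 'I_4) = false by [].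
have n30 : (3 == 0 :> 'I_4) = false by [].
have n31 : (3 == 1 :> 'I_4) = false by [].
have n32 : (3 == 2 :> 'I_4) = false by [].
have n21 : (2 == 1 :> 'I_4) = false by [].
have nE := (n01, n02, n03, (n12, n13, n23), (n10, n20, n30), (n31, n32, n21), eqxx).
have q0 := qE 0; have q1 := qE 1; have q2 := qE 2; have q3 := qE 3.
rewrite a1 in q0; rewrite a2 in q1; rewrite a3 in q2; rewrite a4 in q3.
have /andP[s00 s01'] := s01 0; have /andP[s10 s11] := s01 1.
have /andP[s20 s21] := s01 2; have /andP[s30 s31] := s01 3.
split; last exact: dc.
move=> w; rewrite !sum_ord3 !tnth3 /= => w0 we.
  have B j : w 0 * bary g c (m j) (q 0) + w 1 * bary g c (m j) (q 1)
      + w 2 * bary g c (m j) (q 2) = 0.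
    have := bary_lin0 (m j) (I := 'I_3) (w := w) (p := tnth [tuple q 0; q 1; q 2]).
    by rewrite !sum_ord3 !tnth3 /=; apply.
  have := B 0; have := B 1; have := B 2; have := B 3.
  rewrite q0 q1 q2 !bary_edge !(inj_eq im) !nE /= => b3 b2 b1 b0.
  have w00 : w 0 = 0 by nra.
  have w20 : w 2 = 0 by nra.
  have w10 : w 1 = 0 by lra.
  by apply: ord3_cases; [rewrite -[RHS]w00|rewrite -[RHS]w10|rewrite -[RHS]w20];
    congr w; apply: val_inj.
Qed.
End Shape.

(** * Angles of the sections *)

Section Angles.
Variable R : realType.
Implicit Types (x y z n : pt R) (q : 'I_4 -> pt R) (t : 'I_3 -> pt R) (d : R).
Variables (v : 'I_4 -> pt R) (g : 'I_4 -> pt R) (c : 'I_4 -> R).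
Hypothesis hv : bary_coords v g c.

Lemma hull_extreme_map (m k : nat) (p : 'I_m -> pt R) (q : 'I_k -> pt R) :
  cvx_indep p -> hull p = hull q ->
  exists2 f : 'I_m -> 'I_k, injective f & forall i, p i = q (f i).
Proof.
move=> hp e; have [f hf] := choice (hull_extreme hp e).
exists f => // i j eij; apply: (cvx_indep_inj hp).
by rewrite -(hf i) -(hf j) eij.
Qed.

Lemma hull_leq_card (m k : nat) (p : 'I_m -> pt R) (q : 'I_k -> pt R) :
  cvx_indep p -> hull p = hull q -> (m <= k)%N.
Proof.
move=> hp e; have [f fi _] := hull_extreme_map hp e.
by have := leq_card f fi; rewrite !card_ord.
Qed.

Lemma tri_config_match t t' : tri_config v t -> aff_indep t' ->
  hull t' = hull t -> tri_config v t'.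
Proof.
move=> [J [m [s [im mJ s01 tE]]]] it e.
have [f fi ft] := hull_extreme_map (aff_indep_cvx it) e.
exists J, (m \o f), (s \o f); split=> [|i|i|i] /=.
- exact: inj_comp.
- exact: mJ.
- exact: s01.
- by rewrite ft tE.
Qed.

Lemma quad_config_rot q k : quad_config v q -> quad_config v (fun i => q (k + i)).
Proof.
move=> [m [s [im s01 qE]]].
exists (fun i => m (k + i)), (fun i => s (k + i)); split=> [i j|i|i].
- by move=> /im /addrI.
- exact: s01.
- by rewrite qE addrA.
Qed.

(** Reversing the cyclic order traverses each edge backwards, hence the shift in [m] and the
    parameter [1 - s]. Together with the rotations this carries estimates at vertex 0 to all
    vertices. *)
Lemma quad_config_refl q k : quad_config v q -> quad_config v (fun i => q (k - i)).
Proof.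
move=> [m [s [im s01 qE]]].
exists (fun i => m (k - i + 1)), (fun i => 1 - s (k - i)); split=> [i j|i|i].
- by move=> /im /addIr /addrI /oppr_inj.
- by have /andP[h1 h2] := s01 (k - i); rewrite subr_gt0 h2 /= ltrBlDr ltrDl.
- have e : k - (i + 1) + 1 = k - i by rewrite opprD addrA subrK.
  by rewrite qE e subKr addrC.
Qed.

Lemma ord4_shift (a i : 'I_4) : [\/ i = a, i = a + 1, i = a + 2 | i = a + 3].
Proof.
elim/ord4_cases: a; elim/ord4_cases: i;
  by [constructor 1; apply: val_inj|constructor 2; apply: val_inj|
      constructor 3; apply: val_inj|constructor 4; apply: val_inj].
Qed.

Lemma ord4_shift_neq (a : 'I_4) : [/\ (a == a + 3) = false, (a + 1 == a + 3) = false,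
  (a + 1 + 1 == a + 3) = false, (a + 2 == a + 3) = false &
  [/\ (a + 2 + 1 == a + 3) = true & (a + 3 + 1 == a + 3) = false]].
Proof. by elim/ord4_cases: a. Qed.

(* The coordinate of the vertex a + 3 vanishes on the edges a and a + 1 and is
   positive on the two others, so opposite edges cannot be separated. *)
Lemma quad_config_diagonal q (S T : R) (a b e : 'I_4) : quad_config v q ->
  0 < T < 1 -> b != a -> b != a + 1 -> e != a -> e != a + 1 ->
  (1 - S) *: q a + S *: q (a + 1) = (1 - T) *: q b + T *: q e -> False.
Proof.
move=> [m [s [im s01 qE]]] /andP[T0 T1] ba ba1 ea ea1 h.
have := congr1 (bary g c (m (a + 3))) h; rewrite !bary_line.
have lam i : bary g c (m (a + 3)) (q i) = (1 - s i) * (i == a + 3)%:R + s i * (i + 1 == a + 3)%:R.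
  by rewrite qE bary_edge // !(inj_eq im).
have [n1 n2 n3 n4 [n5 n6]] := ord4_shift_neq a.
rewrite (lam a) (lam (a + 1)) n1 n2 n3 !mulr0 !addr0 !mulr0 addr0 => e0.
have pos i : i != a -> i != a + 1 -> 0 < bary g c (m (a + 3)) (q i).
  have /andP[p1 p2] := s01 i; rewrite lam.
  case: (ord4_shift a i) => ii; rewrite ii ?eqxx // => _ _.
    by rewrite n4 n5 mulr0 add0r mulr1 -ii.
  by rewrite n6 mulr0 addr0 mulr1 subr_gt0 -ii.
have := pos b ba ba1; have := pos e ea ea1 => pe pb.
have : 0 < (1 - T) * bary g c (m (a + 3)) (q b) + T * bary g c (m (a + 3)) (q e).
  by rewrite addr_gt0 // mulr_gt0 // subr_gt0.
by rewrite -e0 ltxx.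
Qed.

(** By [quad_config_diagonal], [q' 0] and [q' 2] cannot be the ends of a side of [q], so
    [f 2 = f 0 + 2]. Then [f] is a rotation or a reflection of the indices modulo 4. *)
Lemma quad_config_match q q' : quad_config v q -> convex_quad q' ->
  hull q' = hull q -> quad_config v q'.
Proof.
move=> hq cq e; have [f fi fq] := hull_extreme_map (convex_quad_cvx cq) e.
have [_ [S [T [S01 T01 dE]]]] := cq.
rewrite !fq in dE.
have fn i j : i != j -> f i != f j by rewrite (inj_eq fi).
have T01' : 0 < 1 - T < 1 by have /andP[? ?] := T01; rewrite subr_gt0 ltrBlDr ltrDl; apply/andP.
have f2 : f 2 = f 0 + 2.
  case: (ord4_shift (f 0) (f 2)) => // h.
  - by have := fn 2 0 isT; rewrite h eqxx.
  - exfalso; apply: (quad_config_diagonal (a := f 0) (b := f 1) (e := f 3) hq T01);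
      rewrite -?h; try exact: fn; exact: dE.
  - have h' : f 0 = f 2 + 1.
      by rewrite h; move: (f 0); elim/ord4_cases; apply: val_inj.
    exfalso; apply: (quad_config_diagonal (S := 1 - S) (a := f 2) (b := f 1) (e := f 3) hq T01);
      rewrite -?h'; try exact: fn.
    by rewrite subKr addrC.
have h1 := fn 1 0 isT; have h3 := fn 3 0 isT; have h12 := fn 1 2 isT.
have h32 := fn 3 2 isT; have h13 := fn 1 3 isT.
rewrite f2 in h12 h32.
case: (ord4_shift (f 0) (f 1)) => k1; rewrite ?k1 ?eqxx // in h1 h12 h13;
case: (ord4_shift (f 0) (f 3)) => k3; rewrite ?k3 ?eqxx // in h3 h32 h13.
- have -> : q' = (fun i => q (f 0 + i)).
    apply/funext => i; rewrite fq; congr q.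
    by elim/ord4_cases: i; rewrite ?addr0.
  exact: quad_config_rot.
- have -> : q' = (fun i => q (f 0 - i)).
    apply/funext => i; rewrite fq; congr q.
    elim/ord4_cases: i; rewrite ?subr0 ?k1 ?f2 ?k3 //;
      by move: (f 0); elim/ord4_cases; apply: val_inj.
  exact: quad_config_refl.
Qed.

(** * Angle bounds from edges of length at most rho and gradients of size at most a / rho *)

Variables (rho a : R).
Hypotheses (a1 : 1 <= a) (edge_le : forall i j, enorm (v i - v j) <= rho)
  (grad_le : forall j, enorm (g j) * rho <= a).

Definition good_angle x y z : Prop := 0 < angle x y z <= acos (cosmin a).

Lemma good_angleC x y z : good_angle x y z -> good_angle z y x.
Proof. by rewrite /good_angle angleC. Qed.

Lemma rho_ge0 : 0 <= rho.
Proof. exact: le_trans (enorm_ge0 _) (edge_le 0 0). Qed.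

Lemma gradient3 i j k : enorm (rho *: (g i + g j - g k)) <= 3 * a.
Proof.
rewrite enormZ ger0_norm ?rho_ge0 //.
have h : enorm (g i + g j - g k) <= enorm (g i) + enorm (g j) + enorm (g k).
  by apply: le_trans (enormB _ _) _; rewrite lerD2r enormD.
have := ler_wpM2l rho_ge0 h.
have := grad_le i; have := grad_le j; have := grad_le k; lra.
Qed.

Lemma gradient2 i j : enorm (rho *: (g i - g j)) <= 2 * a.
Proof.
rewrite enormZ ger0_norm ?rho_ge0 //.
have := ler_wpM2l rho_ge0 (enormB (g i) (g j)).
have := grad_le i; have := grad_le j; lra.
Qed.

Lemma edge_comb2 i j k l (p r : R) : 0 <= p -> 0 <= r ->
  enorm (p *: (v i - v j) + r *: (v k - v l)) <= rho * (p + r).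
Proof.
move=> p0 r0; apply: le_trans (enormD _ _) _; rewrite !enormZ !ger0_norm //.
have := ler_wpM2l p0 (edge_le i j); have := ler_wpM2l r0 (edge_le k l); lra.
Qed.

(** Scaling by [rho] turns a slope of at least 1 / rho along each leg into the form required by
    [cos_lower_bound3]. *)
Lemma good_angle_functional i j k x y z :
  enorm (x - y) <= dotp (rho *: (g i + g j - g k)) (x - y) ->
  enorm (z - y) <= dotp (rho *: (g i + g j - g k)) (z - y) ->
  angle x y z <= acos (cosmin a).
Proof.
move=> hx hz; apply: angle_le_cosmin => //.
exact: cos_lower_bound3 a1 (gradient3 i j k) hx hz.
Qed.

Lemma dotp_gradient3 i j k x y : dotp (rho *: (g i + g j - g k)) (x - y) =
  rho * ((bary g c i x - bary g c i y) + (bary g c j x - bary g c j y)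
         - (bary g c k x - bary g c k y)).
Proof. by rewrite dotpZl dotpBl dotpDl !(baryB g c). Qed.

(** From [t i] to [t j] the coordinate of [m j] rises from 0 to [s j] and that of [m i] falls from
    [s i] to 0, so the functional grows by [rho * (s j + s i)]. By [tB] the leg is at most that
    long. *)
Lemma tri_config_good t i j k : tri_config v t -> j != i -> k != i -> j != k ->
  good_angle (t j) (t i) (t k).
Proof.
move=> [J [m [s [im mJ s01 tE]]]] ji ki jk.
have s0 l : 0 <= s l by have /andP[/ltW] := s01 l.
have tB l : t l - t i = s l *: (v (m l) - v J) + s i *: (v J - v (m i)).
  by rewrite !tE; apply/rowP => r; rewrite !mxE; ring.
have bE l r : bary g c (m r) (t l) = s l * (l == r)%:R.
  by rewrite tE bary_edge // eq_sym (negbTE (mJ r)) mulr0 add0r (inj_eq im).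
have ij : i != j by rewrite eq_sym.
have ik : i != k by rewrite eq_sym.
have kj : k != j by rewrite eq_sym.
have nE := (negbTE ij, negbTE ik, negbTE kj, negbTE ji, negbTE ki, negbTE jk, eqxx).
apply/andP; split.
  have /andP[sj _] := s01 j.
  apply: (angle_gt0 (g := g (m j))); rewrite (baryB g c) !bE !nE /=; lra.
apply: (@good_angle_functional (m j) (m k) (m i)); rewrite dotp_gradient3 !bE !nE;
  rewrite tB; apply: le_trans (edge_comb2 _ _ _ _ (s0 _) (s0 _)) _ => /=; lra.
Qed.

(** At [q 0] the coordinates of [m 2] and [m 3] vanish; towards [q 1] and [q 2] they do not
    decrease, while that of [m 0] falls to 0. Hence [g (m 2) + g (m 3) - g (m 0)] serves both legs
    of the first angle. For the full angles at [q 0] and [q 1], [g (m 1) - g (m 3)] falls along both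
    neighbours of their common side. *)
Lemma quad_config_good q : quad_config v q ->
  [/\ good_angle (q 1) (q 0) (q 2), 0 < angle (q 3) (q 0) (q 1) &
      angle (q 3) (q 0) (q 1) <= acos (cosmin a) \/
      angle (q 0) (q 1) (q 2) <= acos (cosmin a)].
Proof.
move=> [m [s [im s01 qE]]].
have [b1 b2 b3 b4] := ord4_add.
have q0 := qE 0; have q1 := qE 1; have q2 := qE 2; have q3 := qE 3.
rewrite b1 in q0; rewrite b2 in q1; rewrite b3 in q2; rewrite b4 in q3.
have /andP[s00 s01'] := s01 0; have /andP[s10 s11] := s01 1.
have /andP[s20 s21] := s01 2; have /andP[s30 s31] := s01 3.
have E (i j : 'I_4) : (m i == m j) = (i == j) := inj_eq im i j.
have rho0 := rho_ge0.
split.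
- apply/andP; split.
    rewrite angleC; apply: (angle_gt0 (g := g (m 3))); rewrite (baryB g c);
      rewrite ?q0 ?q1 ?q2 !bary_edge // !E /=; lra.
  apply: (@good_angle_functional (m 2) (m 3) (m 0)); rewrite dotp_gradient3;
    rewrite ?q0 ?q1 ?q2 !bary_edge // !E /=.
  + rewrite (_ : _ - _ = s 1 *: (v (m 2) - v (m 1)) + (1 - s 0) *: (v (m 1) - v (m 0))).
      apply: le_trans (edge_comb2 _ _ _ _ (ltW s10) _) _; lra.
    by apply/rowP => r; rewrite !mxE; ring.
  + rewrite (_ : _ - _ = ((1 - s 2) *: (v (m 2) - v (m 1)) + s 2 *: (v (m 3) - v (m 1)))
       + (1 - s 0) *: (v (m 1) - v (m 0))); last first.
      by apply/rowP => r; rewrite !mxE; ring.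
    apply: le_trans (enormD _ _) _.
    have h1 : 0 <= 1 - s 2 by lra.
    have h2 : 0 <= 1 - s 0 by lra.
    have := edge_comb2 (m 2) (m 1) (m 3) (m 1) h1 (ltW s20).
    have := ler_wpM2l h2 (edge_le (m 1) (m 0)).
    have := enormZ (1 - s 0) (v (m 1) - v (m 0)); rewrite (ger0_norm h2) => ->; lra.
- apply: (angle_gt0 (g := g (m 3))); rewrite (baryB g c);
    rewrite ?q0 ?q1 ?q3 !bary_edge // !E /=; lra.
have g3 i j x y : dotp (rho *: (g i - g j)) (x - y) =
   rho * ((bary g c i x - bary g c i y) - (bary g c j x - bary g c j y)).
  by rewrite dotpZl dotpBl !(baryB g c).
have [||h|h] := @cos_lower_bound_adjacent _ (rho *: (g (m 1) - g (m 3)))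
    (q 3 - q 0) (q 2 - q 1) (q 1 - q 0) a a1 (gradient2 (m 1) (m 3)).
- rewrite g3 ?q0 ?q3 !bary_edge // !E /=.
  rewrite (_ : _ - _ = s 0 *: (v (m 0) - v (m 1)) + (1 - s 3) *: (v (m 3) - v (m 0))).
    apply: le_trans (edge_comb2 _ _ _ _ (ltW s00) _) _; lra.
  by apply/rowP => r; rewrite !mxE; ring.
- rewrite g3 ?q1 ?q2 !bary_edge // !E /=.
  rewrite (_ : _ - _ = (1 - s 1) *: (v (m 2) - v (m 1)) + s 2 *: (v (m 3) - v (m 2))).
    apply: le_trans (edge_comb2 _ _ _ _ _ (ltW s20)) _; lra.
  by apply/rowP => r; rewrite !mxE; ring.
- by left; apply: angle_le_cosmin.
- right; apply: angle_le_cosmin => //; rewrite -(edistC (q 1)).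
  by rewrite -[q 0 - q 1]opprB.
Qed.

(** The diagonal cuts the angles at [k] and [k + 2]. The angle at [k + 1] is either bounded itself,
    or it is at most the angle at [k], which then is bounded. *)
Lemma quad_config_half q k : quad_config v q ->
  (forall j, inner_angle q j <= inner_angle q k) ->
  [/\ good_angle (q (k + 1)) (q k) (q (k + 2)),
      good_angle (q k) (q (k + 1)) (q (k + 2)) &
      good_angle (q k) (q (k + 2)) (q (k + 1))].
Proof.
move=> hq hk.
have [h1 _ h3] := quad_config_good (quad_config_rot k hq).
have [_ h2 _] := quad_config_good (quad_config_rot (k + 1) hq).
have [h4 _ _] := quad_config_good (quad_config_refl (k + 2) hq).
have k3 : k - 1 = k + 3 by move: (k); elim/ord4_cases; apply: val_inj.
have k11 : k + 1 + 1 = k + 2 by move: (k); elim/ord4_cases; apply: val_inj.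
have k13 : k + 1 + 3 = k by move: (k); elim/ord4_cases; apply: val_inj.
have k21 : k + 2 - 1 = k + 1 by move: (k); elim/ord4_cases; apply: val_inj.
rewrite addr0 in h1 h3; rewrite addr0 k11 k13 in h2.
rewrite subr0 addrK k21 in h4.
split=> //; last exact: good_angleC.
apply/andP; split=> //; case: h3 => // h3.
have := hk (k + 1); rewrite /inner_angle addrK k11 => h; apply: le_trans h _.
by rewrite k3.
Qed.

Lemma inner_angle_refl q k j :
  inner_angle (fun i => q (k - i)) j = inner_angle q (k - j).
Proof. by rewrite /inner_angle angleC opprD opprB addrA [1 - j]addrC addrA. Qed.

(** The reflection of the indices that sends [i] to [k + k - i] fixes [k] and exchanges the two
    halves. *)
Lemma quad_config_half' q k : quad_config v q ->
  (forall j, inner_angle q j <= inner_angle q k) ->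
  [/\ good_angle (q (k + 3)) (q k) (q (k + 2)),
      good_angle (q k) (q (k + 3)) (q (k + 2)) &
      good_angle (q k) (q (k + 2)) (q (k + 3))].
Proof.
move=> hq hk.
have [|h1 h2 h3] := @quad_config_half (fun i => q (k + k - i)) k (quad_config_refl _ hq).
  by move=> j; rewrite !inner_angle_refl addrK.
have e1 : k + k - (k + 1) = k + 3 by move: (k); elim/ord4_cases; apply: val_inj.
have e2 : k + k - (k + 2) = k + 2 by move: (k); elim/ord4_cases; apply: val_inj.
by rewrite addrK e1 e2 in h1 h2 h3.
Qed.
End Angles.

(** The vertices may be numbered in six ways; the symmetry of [Phi] in its outer arguments reduces
    them all to one angle at each of [x], [y], [z]. *)
Lemma triangle_range (R : realType) (Phi : pt R -> pt R -> pt R -> Prop)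
    (t : 'I_3 -> pt R) (x y z : pt R) :
  (forall u v w, Phi u v w -> Phi w v u) ->
  x != y -> y != z -> x != z -> range t = [set x; y; z] ->
  Phi y x z -> Phi x y z -> Phi x z y ->
  forall i, Phi (t (i - 1)) (t i) (t (i + 1)).
Proof.
move=> sy xy yz xz e h1 h2 h3.
have yx := xy; have zy := yz; have zx := xz.
rewrite eq_sym in yx; rewrite eq_sym in zy; rewrite eq_sym in zx.
have tE i : [\/ t i = x, t i = y | t i = z].
  have : range t (t i) by exists i.
  by rewrite e => -[[]|] /= ->; [constructor 1|constructor 2|constructor 3].
have sx u : [set x; y; z] u -> [\/ t 0 = u, t 1 = u | t 2 = u].
  rewrite -e => -[i _ <-]; elim/ord3_cases: i.
  - by constructor 1; congr t; apply: val_inj.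
  - by constructor 2; congr t; apply: val_inj.
  - by constructor 3; congr t; apply: val_inj.
have X := sx x (or_introl (or_introl erefl)).
have Y := sx y (or_introl (or_intror erefl)).
have Z := sx z (or_intror erefl).
have i01 : Ordinal (isT : (0 < 3)%N) - 1 = 2 :> 'I_3 by apply: val_inj.
have i02 : Ordinal (isT : (0 < 3)%N) + 1 = 1 :> 'I_3 by apply: val_inj.
have i11 : Ordinal (isT : (1 < 3)%N) - 1 = 0 :> 'I_3 by apply: val_inj.
have i12 : Ordinal (isT : (1 < 3)%N) + 1 = 2 :> 'I_3 by apply: val_inj.
have i21 : Ordinal (isT : (2 < 3)%N) - 1 = 1 :> 'I_3 by apply: val_inj.
have i22 : Ordinal (isT : (2 < 3)%N) + 1 = 0 :> 'I_3 by apply: val_inj.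
have j0 : Ordinal (isT : (0 < 3)%N) = 0 :> 'I_3 by apply: val_inj.
have j1 : Ordinal (isT : (1 < 3)%N) = 1 :> 'I_3 by apply: val_inj.
have j2 : Ordinal (isT : (2 < 3)%N) = 2 :> 'I_3 by apply: val_inj.
have neqs := (negbTE xy, negbTE yz, negbTE xz, negbTE yx, negbTE zy, negbTE zx).
have ax : [/\ Phi (t 2) (t 0) (t 1), Phi (t 0) (t 1) (t 2) & Phi (t 1) (t 2) (t 0)].
  case: (tE 0) X Y Z => e0; case: (tE 1) => e1; case: (tE 2) => e2; rewrite e0 e1 e2;
  move=> [] /eqP X [] /eqP Y [] /eqP Z; rewrite ?neqs // in X Y Z;
  by split; auto.
by have [p0 p1 p2] := ax; apply: ord3_cases; rewrite ?i01 ?i02 ?i11 ?i12 ?i21 ?i22 ?j0 ?j1 ?j2.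
Qed.

(** * Null sets for the two-dimensional Hausdorff measure *)

Section NullSets.
Variable R : realType.
Implicit Types (x y z p : pt R) (A B : set (pt R)) (d e eps : R).

(** Hausdorff-null sets, with real bounds [d n] for the diameters and finite partial sums in place
    of extended reals and series. That the mesh size can be omitted is part of [meas2_gt0]. *)
Definition null_set A : Prop := forall eps, 0 < eps ->
  exists (U : nat -> set (pt R)) (d : nat -> R),
    [/\ A `<=` \bigcup_n U n, forall n, 0 <= d n,
        forall n x y, U n x -> U n y -> enorm (x - y) <= d n &
        forall N, \sum_(n < N) d n ^+ 2 <= eps].

Lemma ediam_ge0 A : (0 <= ediam A)%E.
Proof. by apply: ereal_sup_ubound; left. Qed.

Lemma ediam_le A d : 0 <= d -> (forall x y, A x -> A y -> enorm (x - y) <= d) ->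
  (ediam A <= d%:E)%E.
Proof.
move=> d0 h; apply: ge_ereal_sup => _ [->|[[x y] [/= hx hy] <-]].
  by rewrite lee_fin.
by rewrite lee_fin; exact: h.
Qed.

Lemma edist_le_ediam A x y : A x -> A y -> ((enorm (x - y))%:E <= ediam A)%E.
Proof. by move=> hx hy; apply: ereal_sup_ubound; right; exists (x, y). Qed.

Lemma lee_sum_last (u : nat -> \bar R) n : (forall k, 0 <= u k)%E ->
  (u n <= \sum_(0 <= k < n.+1) u k)%E.
Proof.
by move=> u0; rewrite big_nat_recr //=; apply: leeDr; apply: sume_ge0 => k _.
Qed.

Lemma lee_sqre (x : \bar R) d : (0 <= x)%E -> 0 <= d ->
  (x ^+ 2 <= (d ^+ 2)%:E)%E = (x <= d%:E)%E.
Proof.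
rewrite EFin_expe; case: x => [r| |] r0 d0; last by [].
  by rewrite -!EFin_expe !lee_fin ler_pXn2r ?nnegrE // -lee_fin.
by rewrite (expe2 +oo) mulyy -EFin_expe.
Qed.

Lemma null_set_cover A : null_set A <-> forall eps, 0 < eps ->
  exists U : nat -> set (pt R), A `<=` \bigcup_n U n /\
    (\sum_(0 <= n <oo) ediam (U n) ^+ 2 <= eps%:E)%E.
Proof.
split=> h eps e0; have [U] := h _ e0.
  move=> [d [hA d0 hd hs]]; exists U; split=> //.
  have le1 n : (ediam (U n) ^+ 2 <= (d n ^+ 2)%:E)%E.
    by rewrite lee_sqre ?ediam_ge0 //; exact: ediam_le (d0 n) (hd n).
  apply: le_trans (lee_nneseries _ (fun n _ => le1 n)) _.
    by move=> n _ _; rewrite expe_ge0 // ediam_ge0.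
  apply: lime_le.
    by apply: is_cvg_nneseries => n _ _; rewrite lee_fin sqr_ge0.
  by near=> N; rewrite big_mkord sumEFin lee_fin.
move=> [hA hs]; exists U, (fun n => fine (ediam (U n))).
have pos n : (0 <= ediam (U n) ^+ 2)%E by rewrite expe_ge0 // ediam_ge0.
have part N : (\sum_(0 <= n < N) ediam (U n) ^+ 2 <= eps%:E)%E.
  by apply: le_trans (nneseries_lim_ge N (fun n _ _ => pos n)) hs.
have fin n : ediam (U n) \is a fin_num.
  have := le_trans (lee_sum_last n pos) (part n.+1); rewrite expe2.
  by have := ediam_ge0 (U n); case: (ediam (U n)) => [r| |] // _; rewrite mulyy.
split=> // [n|n x y hx hy|N].
- by rewrite fine_ge0 // ediam_ge0.
- by rewrite -lee_fin fineK //; exact: edist_le_ediam.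
- have := part N; rewrite big_mkord -lee_fin -sumEFin; congr (_ <= _)%E.
  by apply: eq_bigr => n _; rewrite EFin_expe fineK.
Unshelve. all: by end_near. Qed.

(** A cover whose squared diameters sum to at most [delta ^+ 2] has all diameters at most [delta],
    so the mesh restriction costs nothing. Conversely, if all covers have a sum above some [e], the
    mesh size 1 already gives a positive infimum. *)
Lemma meas2_gt0 A : (0 < meas2 A)%E <-> ~ null_set A.
Proof.
have pi4 : (0 < (pi / 4 : R)%:E)%E by rewrite lte_fin divr_gt0 // pi_gt0.
split.
  move=> + /null_set_cover h; apply/negP; rewrite -leNgt /meas2.
  rewrite -[leRHS](mule0 (pi / 4 : R)%:E) lee_pmul2l //.
  apply: ge_ereal_sup => _ [delta d0 <-]; apply/lee_addgt0Pr => e e0.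
  rewrite add0e.
  have [|U [hA hs]] := h (Num.min e (delta ^+ 2)).
    by rewrite lt_min e0 exprn_gt0.
  apply: (@le_trans _ _ (\sum_(0 <= n <oo) ediam (U n) ^+ 2)%E).
    apply: ereal_inf_lbound; exists U => //; split=> // n.
    have pos k : (0 <= ediam (U k) ^+ 2)%E by rewrite expe_ge0 // ediam_ge0.
    have : (ediam (U n) ^+ 2 <= (delta ^+ 2)%:E)%E.
      have := le_trans (nneseries_lim_ge n.+1 (fun k _ _ => pos k)) hs.
      move=> /(le_trans (lee_sum_last n pos)) hn; apply: (le_trans hn).
      by rewrite lee_fin ge_min lexx orbT.
    by rewrite lee_sqre ?ediam_ge0 // ltW.
  by apply: le_trans hs _; rewrite lee_fin ge_min lexx.
move=> hn; rewrite /meas2 mule_gt0 //.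
have {hn}[e [e0 he]] : exists e, 0 < e /\ forall U : nat -> set (pt R),
    A `<=` \bigcup_n U n -> (e%:E < \sum_(0 <= n <oo) ediam (U n) ^+ 2)%E.
  apply: contrapT => hh; apply: hn; apply/null_set_cover => eps e0.
  apply: contrapT => hU; apply: hh; exists eps; split=> // U AU.
  by rewrite ltNge; apply/negP => le; apply: hU; exists U.
apply: (@lt_le_trans _ _ e%:E); first by rewrite lte_fin.
apply: (@le_trans _ _ (ereal_inf [set (\sum_(0 <= n <oo) ediam (U n) ^+ 2)%E | U in
        [set U : nat -> set (pt R) | A `<=` \bigcup_n U n /\
           forall n, (ediam (U n) <= (1 : R)%:E)%E]])).
  by apply: le_ereal_inf_tmp => _ [U [AU _] <-]; exact/ltW/he.
by apply: ereal_sup_ubound; exists 1 => //=.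
Qed.

Lemma null_set_sub A B : A `<=` B -> null_set B -> null_set A.
Proof.
move=> AB h eps e0; have [U [d [hB d0 hd hs]]] := h _ e0.
by exists U, d; split=> //; exact: subset_trans hB.
Qed.

Lemma null_setU A B : null_set A -> null_set B -> null_set (A `|` B).
Proof.
move=> hA hB eps e0; have e2 : 0 < eps / 2 by rewrite divr_gt0.
have [U [d [hU d0 hd hs]]] := hA _ e2; have [V [e [hV f0 he ht]]] := hB _ e2.
(* Even indices carry the cover of [A], odd ones that of [B]. *)
exists (fun n => if odd n then V n./2 else U n./2),
  (fun n => if odd n then e n./2 else d n./2); split.
- move=> x [/hU[n _ hn]|/hV[n _ hn]].
    by exists n.*2 => //=; rewrite odd_double doubleK.
  by exists n.*2.+1 => //=; rewrite odd_double /= uphalf_double.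
- by move=> n; case: ifP.
- by move=> n x y; case: ifP => _; [exact: he|exact: hd].
move=> N.
have dbl M : \sum_(n < M.*2) (if odd n then e n./2 else d n./2) ^+ 2 =
    \sum_(n < M) d n ^+ 2 + \sum_(n < M) e n ^+ 2.
  elim: M => [|M IH]; first by rewrite !big_ord0 addr0.
  rewrite doubleS !big_ord_recr /= IH odd_double /= doubleK uphalf_double.
  by rewrite -!addrA; congr (_ + _); rewrite addrCA.
apply: (@le_trans _ _ (\sum_(n < N.*2) (if odd n then e n./2 else d n./2) ^+ 2)).
  have le : (N <= N.*2)%N by rewrite -addnn leq_addr.
  rewrite -!(big_mkord xpredT (fun n => (if odd n then e n./2 else d n./2) ^+ 2)).
  rewrite (big_cat_nat (leq0n N) le) /= lerDl.
  by apply: sumr_ge0 => i _; exact: sqr_ge0.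
by rewrite dbl; have := hs N; have := ht N; lra.
Qed.

Lemma null_set0 : null_set set0.
Proof.
move=> eps e0; exists (fun _ => set0), (fun _ => 0); split=> // N.
by rewrite big1 ?ltW // => i _; rewrite expr0n.
Qed.

Lemma null_set_bigcup (I : choiceType) (D : set I) (F : I -> set (pt R)) :
  finite_set D -> (forall i, D i -> null_set (F i)) ->
  null_set (\bigcup_(i in D) F i).
Proof.
move=> /finite_seqP[s ->]; elim: s => [|i s IH] h.
  by apply: null_set_sub null_set0 => x [j].
apply: (@null_set_sub _ (F i `|` \bigcup_(j in [set` s]) F j)).
  move=> x [j /=]; rewrite inE => /orP[/eqP ->|js] hx; first by left.
  by right; exists j.
apply: null_setU; first by apply: h; rewrite /= inE eqxx.
by apply: IH => j /= js; apply: h; rewrite /= inE js orbT.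
Qed.

(** About [2 * M * N] pieces of length [enorm u / N] cover the segment, and their squared lengths
    sum to order 1 / N. *)
Lemma null_set_segment p u (M : R) A :
  (forall x, A x -> exists k : R, x = p + k *: u /\ `|k| <= M) -> null_set A.
Proof.
move=> hA eps e0.
have [A0|/set0P[x0 /hA[k0 [_ kM]]]] := eqVneq A set0.
  by rewrite A0; exact: null_set0.
have M0 : 0 <= M := le_trans (normr_ge0 _) kM.
pose C := (2 * M + 1) * enorm u ^+ 2 / eps.
pose N := (Num.truncn C).+1.
have CN : C < N%:R by apply: truncnS_gt.
have N1 : 1 <= N%:R :> R by rewrite ler1n.
have N0 : 0 < N%:R :> R by lra.
pose K := (Num.truncn (2 * M * N%:R)).+1.
exists (fun n => [set x | exists k : R, [/\ x = p + k *: u, `|k| <= M &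
    n%:R <= (k + M) * N%:R <= n.+1%:R]]),
  (fun n => if (n < K)%N then enorm u / N%:R else 0); split.
- move=> x /hA[k [-> kM']]; have := kM'; rewrite ler_norml => /andP[k1 k2].
  have t0 : 0 <= (k + M) * N%:R by rewrite mulr_ge0 //; lra.
  exists (Num.truncn ((k + M) * N%:R)) => //=; exists k; split=> //.
  by have /andP[h1 h2] := truncn_itv t0; rewrite h1 /= ltW.
- by move=> n; case: ifP => // _; rewrite divr_ge0 ?enorm_ge0 // ltW.
- move=> n x y [k [-> kM' /andP[k1 k2]]] [l [-> _ /andP[l1 l2]]].
  have -> : p + k *: u - (p + l *: u) = (k - l) *: u.
    by apply/rowP => r; rewrite !mxE; ring.
  rewrite enormZ.
  have kl : `|k - l| <= N%:R^-1.
    rewrite ler_norml; rewrite -natr1 in k2 l2.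
    have NV : N%:R * N%:R^-1 = 1 :> R by rewrite mulfV ?gt_eqF.
    apply/andP; split.
      by rewrite lerNl -(ler_pM2r N0) mulVf ?gt_eqF //; lra.
    by rewrite -(ler_pM2r N0) mulVf ?gt_eqF //; lra.
  have nK : (n < K)%N.
    have := kM'; rewrite ler_norml => /andP[_ kM2].
    rewrite /K ltnS truncn_ge_nat //; last by rewrite !mulr_ge0 // ltW.
    by apply: le_trans k1 _; rewrite ler_pM2r //; lra.
  by rewrite nK mulrC ler_wpM2l ?enorm_ge0.
move=> m.
have u2 : 0 <= (enorm u / N%:R) ^+ 2 := sqr_ge0 _.
apply: (@le_trans _ _ (K%:R * (enorm u / N%:R) ^+ 2)).
  apply: (@le_trans _ _ ((minn m K)%:R * (enorm u / N%:R) ^+ 2)); last first.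
    by rewrite ler_wpM2r // ler_nat geq_minr.
  elim: m => [|m IH]; first by rewrite big_ord0 min0n mul0r.
  rewrite big_ord_recr /=; have := IH; case: ifP => mK.
    have -> : minn m.+1 K = (minn m K).+1 by move: mK; lia.
    by rewrite -[(minn m K).+1%:R]natr1 mulrDl mul1r lerD2r.
  have -> : minn m.+1 K = minn m K by move: mK; lia.
  by rewrite expr0n addr0.
have KM : K%:R <= 2 * M * N%:R + 1.
  rewrite /K -[X in X <= _]natr1 lerD2r.
  have MN0 : 0 <= 2 * M * N%:R by rewrite !mulr_ge0 // ltW.
  by have /andP[] := truncn_itv MN0.
apply: (@le_trans _ _ ((2 * M + 1) * N%:R * (enorm u / N%:R) ^+ 2)).
  by apply: ler_wpM2r => //; lra.
have -> : (2 * M + 1) * N%:R * (enorm u / N%:R) ^+ 2 = (2 * M + 1) * enorm u ^+ 2 / N%:R.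
  by field; exact: lt0r_neq0.
rewrite ler_pdivrMr // -ler_pdivrMl // mulrC; exact: ltW.
Qed.

(** A bounded set of collinear points lies in a segment and is null. *)
Lemma noncollinear_nonnull A (B : R) : ~ null_set A ->
  (forall x y, A x -> A y -> enorm (x - y) <= B) -> noncollinear A.
Proof.
move=> hA hB; apply: contrapT => nc; apply: hA.
have [->|/set0P[p Ap]] := eqVneq A set0; first exact: null_set0.
have [[q [Aq qp]]|nq] := pselect (exists q, A q /\ q != p); last first.
  apply: (@null_set_segment p 0 0) => x Ax; exists 0; rewrite normr0 scale0r addr0.
  by split=> //; apply/eqP; apply: contrapT => /negP xp; apply: nq; exists x.
have qp0 : 0 < enorm (q - p) by rewrite enorm_gt0 subr_eq0.
apply: (@null_set_segment p (q - p) (B / enorm (q - p))) => z Az.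
have [k zk] : exists k : R, z - p = k *: (q - p).
  by apply: contrapT => hk; apply: nc; exists p, q, z.
exists k; split; first by rewrite -zk addrC subrK.
by rewrite ler_pdivlMr // -enormZ -zk hB.
Qed.

Lemma mu_square_itv (a d : R) : 0 <= d ->
  lebesgue_measure (`[a - d, a + d]%classic : set R) = (2 * d)%:E.
Proof.
move=> d0; rewrite lebesgue_measure_itv /= lte_fin; case: ltP => h.
  by rewrite EFinN -EFinD; congr (_%:E); ring.
by congr (_%:E); lra.
Qed.

(* A null set cannot project onto a square: the squares of side 2 d_n around the
   images of the covering sets have total area at most 4 eps. *)
Lemma square_image_nonnull A (f1 f2 : pt R -> R) (a b e : R) : 0 < e ->
  (forall x y, `|f1 x - f1 y| <= enorm (x - y)) ->
  (forall x y, `|f2 x - f2 y| <= enorm (x - y)) ->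
  (forall s t, `|s - a| < e -> `|t - b| < e -> exists x, [/\ A x, f1 x = s & f2 x = t]) ->
  ~ null_set A.
Proof.
move=> e0 l1 l2 hA nA.
have [|U [d [AU d0 hd hs]]] := nA (e ^+ 2 / 2); first by rewrite divr_gt0 // exprn_gt0.
pose mu := (@lebesgue_measure R \x @lebesgue_measure R)%E.
pose I (x r : R) : set (measurableTypeR R) := `[x - r, x + r]%classic.
(* If [U n] is empty, [get (U n)] is an arbitrary point and the extra square merely enlarges the
   cover. *)
pose F n := I (f1 (get (U n))) (d n) `*` I (f2 (get (U n))) (d n).
(* The closed square of half side [e'] lies in the open one where preimages exist, and its area
   [9 / 4 * e ^+ 2] exceeds the bound [2 * e ^+ 2] for the cover. *)
pose e' := e * (3 / 4).
have e'0 : 0 <= e' by rewrite mulr_ge0 // ltW.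
have mI (u r : R) : measurable (I u r) by exact: measurable_itv.
have mE (u w r : R) (r0 : 0 <= r) : mu (I u r `*` I w r) = ((2 * r) ^+ 2)%:E.
  have mI1 (s : R) : (@lebesgue_measure R) (I s r) = (2 * r)%:E := mu_square_itv s r0.
  transitivity ((2 * r)%:E * (2 * r)%:E)%E; last by rewrite -EFinM expr2.
  rewrite /mu product_measure1E //; congr (_ * _)%E; exact: mI1.
have cover : I a e' `*` I b e' `<=` \bigcup_n F n.
  move=> [s t] /= []; rewrite /I /= !in_itv /= => /andP[s1 s2] /andP[t1 t2].
  have [||x [Ax <- <-]] := hA s t.
  - by rewrite ltr_norml /e' in s1 s2 *; apply/andP; split; lra.
  - by rewrite ltr_norml /e' in t1 t2 *; apply/andP; split; lra.
  have [n _ Ux] := AU _ Ax; exists n => //; rewrite /F /I /= !in_itv /=.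
  have Ug : U n (get (U n)) by apply: getPex; exists x.
  have := le_trans (l1 x (get (U n))) (hd n _ _ Ux Ug).
  have := le_trans (l2 x (get (U n))) (hd n _ _ Ux Ug).
  rewrite !ler_norml => /andP[k1 k2] /andP[k3 k4].
  by split; apply/andP; split; lra.
have sub : (mu (I a e' `*` I b e') <= \sum_(0 <= n <oo) mu (F n))%E.
  by apply: measure_sigma_subadditive cover => [n|]; exact: measurableX.
have h : (\sum_(0 <= n <oo) mu (F n) <= (4 * (e ^+ 2 / 2))%:E)%E.
  apply: lime_le; first by apply: is_cvg_nneseries => n _ _; exact: measure_ge0.
  near=> N; rewrite big_mkord.
  under eq_bigr do rewrite /F mE // exprMn.
  rewrite sumEFin lee_fin -mulr_sumr.
  have := hs N; rewrite expr2; lra.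
have := le_trans sub h; rewrite mE //.
rewrite lee_fin /e'; have : 0 < e ^+ 2 by rewrite exprn_gt0.
rewrite !expr2; nra.
Unshelve. all: by end_near. Qed.
End NullSets.

(** * Lipschitz graphs *)

Section Topology.
Variable R : realType.
Implicit Types (x y z n p : pt R) (G S : set (pt R)) (e : R).

Lemma rV_norm_le (k : nat) (u : 'rV[R]_k) (r : R) : 0 <= r ->
  (forall i, `|u 0 i| <= r) -> `|u| <= r.
Proof.
move=> r0 h; have [u0|u0] := eqVneq `|u| 0; first by rewrite u0.
have [[i j]] : exists i : 'I_1 * 'I_k, mx_norm u = `|u i.1 i.2| by exact: mx_norm_neq0.
by rewrite /= [LHS](_ : _ = `|u|) // => ->; rewrite ord1.
Qed.

Lemma rV_coord_le (k : nat) (u : 'rV[R]_k) i : `|u 0 i| <= `|u|.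
Proof.
rewrite [leRHS](_ : _ = mx_norm u) // mx_normrE.
exact: (le_bigmax _ (fun ij : 'I_1 * 'I_k => `|u ij.1 ij.2|) (0, i)).
Qed.

Lemma nbhs_enorm p (A : set (pt R)) :
  nbhs p A <-> exists2 e, 0 < e & forall x, enorm (x - p) < e -> A x.
Proof.
have le1 (u : pt R) : `|u| <= enorm u.
  by apply: rV_norm_le; [exact: enorm_ge0|exact: coord_le_enorm].
have le2 (u : pt R) : enorm u <= 3 * `|u|.
  by apply: enorm_le_coord => i; exact: rV_coord_le.
split.
  move=> /nbhs_ballP[e /= e0 h]; exists e => // x xe; apply: h.
  rewrite -ball_normE /ball_ /= distrC; exact: le_lt_trans (le1 _) xe.
move=> [e e0 h]; apply/nbhs_ballP; exists (e / 3) => /=; first by rewrite divr_gt0.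
move=> x; rewrite -ball_normE /ball_ /= distrC => xe; apply: h.
by apply: le_lt_trans (le2 _) _; rewrite mulrC -ltr_pdivlMr.
Qed.

Lemma closed_far G x : closed G -> ~ G x ->
  exists2 e, 0 < e & forall y, enorm (y - x) < e -> ~ G y.
Proof.
move=> cG nG; apply/nbhs_enorm; apply: open_nbhs_nbhs; split=> //.
exact: closed_openC.
Qed.

(** Connectedness of the unit interval, through the supremum of the initial segments on which [P]
    holds. Openness is asked only for [t < 1] because the end point may lie on the boundary of a
    section. *)
Lemma unit_interval_ind (P : R -> Prop) : P 0 ->
  (forall t, 0 <= t < 1 -> P t -> exists2 e, 0 < e & forall s, `|s - t| < e -> P s) ->
  (forall t, 0 <= t <= 1 -> ~ P t -> exists2 e, 0 < e & forall s, `|s - t| < e -> ~ P s) ->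
  P 1.
Proof.
move=> P0 Popen Pclosed.
pose A := [set t | 0 <= t <= 1 /\ forall s, 0 <= s <= t -> P s].
have A0 : A 0.
  split=> [|s /andP[s1 s2]]; first by rewrite lexx ler01.
  by have -> : s = 0 by apply/eqP; rewrite eq_le s1 s2.
have hA : has_sup A.
  by split; [exists 0 | exists 1 => t [/andP[]]].
set T := sup A.
have T0 : 0 <= T by apply: ub_le_sup => //; have [] := hA.
have T1 : T <= 1 by apply: ge_sup; [exists 0|move=> t [/andP[]]].
have below s : 0 <= s -> s < T -> P s.
  move=> s0 sT; have sT0 : 0 < T - s by rewrite subr_gt0.
  have [t [_ h] st] := sup_adherent sT0 hA.
  by apply: h; rewrite s0 /=; rewrite -/T in st; lra.
have PT : P T.
  apply: contrapT => nP; have [|e e0 h] := Pclosed T _ nP; first by rewrite T0.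
  have [T00|Tp] := eqVneq T 0; first by rewrite T00 in nP.
  have Tpos : 0 < T by rewrite lt_def Tp.
  pose s := Num.max 0 (T - e / 2).
  have sT : s < T by rewrite gt_max Tpos /=; lra.
  have s0 : 0 <= s by rewrite le_max lexx.
  apply: (h s); last exact: below.
  have : T - e / 2 <= s by rewrite le_max lexx orbT.
  by rewrite ltr_norml; move=> ?; apply/andP; split; lra.
have leT s : 0 <= s -> s <= T -> P s.
  by move=> s0; rewrite le_eqVlt => /orP[/eqP ->|] //; exact: below.
have [T1'|T1'] := eqVneq T 1; first by rewrite -T1'.
have Tlt : T < 1 by rewrite lt_neqAle T1' T1.
have [|e e0 h] := Popen T _ PT; first by rewrite T0.
pose r := Num.min 1 (T + e / 2).
have rT : T < r by rewrite lt_min Tlt /=; lra.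
have : A r.
  split; first by rewrite (le_trans T0 (ltW rT)) ge_min lexx.
  move=> s /andP[s0 sr]; have [sT|sT] := leP s T; first exact: leT.
  apply: h; have : r <= T + e / 2 by rewrite ge_min lexx orbT.
  by rewrite ltr_norml => ?; apply/andP; split; lra.
by move=> /(ub_le_sup hA.2); rewrite -/T leNgt rT.
Qed.

Definition local_graph G p (Q : 'M[R]_3) (g : 'rV[R]_2 -> R) (L e : R) : Prop :=
  [/\ Q *m Q^T = 1%:M, 0 <= L, forall w w', `|g w - g w'| <= L * `|w - w'|, 0 < e &
      forall x, enorm (x - p) < e ->
        G x <-> (x *m Q) 0 ord_max = g (lsubmx (x *m Q : 'rV[R]_(2 + 1)))].

Lemma lipschitz_surface_graph G p : lipschitz_surface G -> G p ->
  exists Q g L e, local_graph G p Q g L e.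
Proof.
move=> [_ /(_ p)] h /h[Q [g [QQ [L [Lr hL]] /nbhs_enorm[e e0 he]]]].
exists Q, g, (`|L| + 1), e; split=> // w w'.
(* The Lipschitz bound is available for every constant greater than [L], in particular for the
   nonnegative one chosen here. *)
apply: (hL (`|L| + 1) _ (w, w')); last by split.
by apply: le_lt_trans (real_ler_norm Lr) _; rewrite ltrDl.
Qed.

Lemma dotp_split (u y : pt R) : dotp u y =
  \sum_(i < 2) u 0 (@lshift 2 1 i) * y 0 (@lshift 2 1 i) + u 0 ord_max * y 0 ord_max.
Proof.
rewrite /dotp (@big_split_ord _ _ _ 2 1) /= big_ord1; congr (_ + _ * _);
  by congr (_ _ _); apply: val_inj.
Qed.

Section Graph.
Variables (G : set (pt R)) (p : pt R) (Q : 'M[R]_3) (g : 'rV[R]_2 -> R) (L e : R).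
Hypothesis hG : local_graph G p Q g L e.

Let w0 : 'rV[R]_2 := lsubmx (p *m Q : 'rV[R]_(2 + 1)).

Definition chart (w : 'rV[R]_2) : pt R :=
  (row_mx w (g w)%:M : 'rV[R]_(2 + 1)) *m Q^T.

Lemma dotp_isometry (u y : pt R) : dotp (u *m Q) (y *m Q) = dotp u y.
Proof.
have [QQ _ _ _ _] := hG.
by rewrite !dotp_mulmx trmx_mul mulmxA -(mulmxA y) QQ mulmx1.
Qed.

Lemma enorm_isometry (u : pt R) : enorm (u *m Q) = enorm u.
Proof. by rewrite /enorm dotp_isometry. Qed.

Lemma chartQ w : chart w *m Q = (row_mx w (g w)%:M : 'rV[R]_(2 + 1)).
Proof.
have [QQ _ _ _ _] := hG.
by rewrite /chart -mulmxA (mulmx1C QQ) mulmx1.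
Qed.

Lemma chart_max w : (chart w *m Q) 0 ord_max = g w.
Proof.
rewrite chartQ (_ : ord_max = @rshift 2 1 ord0); last exact: val_inj.
by rewrite (@row_mxEr R 1 2 1) mxE eqxx mulr1n.
Qed.

Lemma chart_coord w i : (chart w *m Q) 0 (@lshift 2 1 i) = w 0 i.
Proof. by rewrite chartQ (@row_mxEl R 1 2 1). Qed.

Lemma surface_chart : G p -> p = chart w0.
Proof.
have [QQ _ _ e0 hG'] := hG.
move=> Gp; have pQ : (p *m Q) 0 ord_max = g w0.
  by apply/hG' => //; rewrite subrr enorm0.
have rE : (g w0)%:M = rsubmx (p *m Q : 'rV[R]_(2 + 1)) :> 'M[R]_1.
  apply/rowP => j; rewrite ord1 !mxE eqxx mulr1n -pQ mxE.
  by apply: eq_bigr => i _; congr (_ * Q _ _); apply: val_inj.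
have rowE : row_mx w0 (g w0)%:M = (p *m Q : 'rV[R]_(2 + 1)).
  by rewrite rE hsubmxK.
by rewrite /chart rowE -mulmxA QQ mulmx1.
Qed.

Lemma chart_dist w : G p -> enorm (chart w - p) <= 3 * ((1 + L) * `|w - w0|).
Proof.
move=> Gp; have [QQ L0 hL _ _] := hG.
rewrite {1}(surface_chart Gp) -enorm_isometry mulmxBl; apply: enorm_le_coord => i.
rewrite mxE [X in _ + X]mxE.
case: (@splitP 2 1 i) => j ij.
  have -> : i = @lshift 2 1 j by exact: val_inj.
  rewrite !chart_coord; have := rV_coord_le (w - w0) j; rewrite !mxE => h.
  by apply: le_trans h _; rewrite ler_peMl // lerDl.
have -> : i = ord_max by apply: val_inj; rewrite /= ij ord1.
rewrite !chart_max; apply: le_trans (hL _ _) _.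
by rewrite ler_wpM2r // lerDr.
Qed.

Lemma chart_near : G p -> exists2 r, 0 < r & forall w, `|w - w0| < r ->
  enorm (chart w - p) < e /\ G (chart w).
Proof.
move=> Gp; have [QQ L0 hL e0 hG'] := hG.
have c0 : 0 < 3 * (1 + L) by lra.
exists (e / (3 * (1 + L))); first by rewrite divr_gt0.
move=> w; rewrite ltr_pdivlMr // => wr.
have near : enorm (chart w - p) < e.
  by apply: le_lt_trans (chart_dist w Gp) _; rewrite mulrA mulrC.
split=> //; apply/hG' => //; rewrite chart_max; congr g.
by apply/rowP => i; rewrite mxE chart_coord.
Qed.

(* If n has no component along the graph direction, moving the base point along
   n leaves the plane. *)
Lemma surface_eq_plane n (c r : R) : G p -> n != 0 -> 0 < r ->
  (forall x, enorm (x - p) < r -> G x -> dotp n x = c) ->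
  exists2 r', 0 < r' & forall x, enorm (x - p) < r' -> dotp n x = c -> G x.
Proof.
move=> Gp n0 r0 hr; have [QQ L0 hL e0 hG'] := hG.
have [m mE] : exists m, m = n *m Q by exists (n *m Q).
have nE x : dotp n x = \sum_(i < 2) m 0 (@lshift 2 1 i) * (x *m Q) 0 (@lshift 2 1 i)
    + m 0 ord_max * (x *m Q) 0 ord_max by rewrite -dotp_split mE dotp_isometry.
have [s s0 hs] := chart_near Gp.
have c0 : 0 < 3 * (1 + L) by lra.
pose s' := Num.min s (r / (3 * (1 + L))).
have s'0 : 0 < s' by rewrite lt_min s0 divr_gt0.
have pl w : `|w - w0| < s' ->
    \sum_(i < 2) m 0 (@lshift 2 1 i) * w 0 i + m 0 ord_max * g w = c.
  rewrite lt_min => /andP[w1 w2]; have [_ Gw] := hs _ w1.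
  have := hr (chart w) _ Gw; rewrite nE chart_max.
  under eq_bigr do rewrite chart_coord.
  apply; apply: le_lt_trans (chart_dist w Gp) _.
  by rewrite mulrA mulrC -ltr_pdivlMr.
have [m2|m2] := eqVneq (m 0 ord_max) 0.
  exfalso.
  pose d : 'rV[R]_2 := \row_i m 0 (@lshift 2 1 i).
  have dn : 0 < 1 + `|d| by rewrite ltr_pwDl.
  pose k := s' / 2 / (1 + `|d|).
  have k0 : 0 < k by rewrite !divr_gt0.
  have h1 : `|w0 + k *: d - w0| < s'.
    rewrite addrAC subrr add0r normrZ gtr0_norm // /k -mulrA mulrC.
    have h : (1 + `|d|)^-1 * `|d| < 1 by rewrite mulrC ltr_pdivrMr // mul1r ltrDr.
    have : (1 + `|d|)^-1 * `|d| * (s' / 2) < 1 * (s' / 2) by rewrite ltr_pM2r // divr_gt0.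
    lra.
  have := pl _ h1; rewrite -(pl w0) ?subrr ?normr0 // m2 !mul0r !addr0.
  move=> /eqP; rewrite -subr_eq0 -sumrB.
  under eq_bigr do rewrite -mulrBr !mxE addrAC subrr add0r mulrCA.
  rewrite -mulr_sumr mulf_eq0 (gt_eqF k0) /=.
  move=> /eqP z.
  have : dotp m m = 0 by rewrite dotp_split z m2 mul0r addr0.
  rewrite mE dotp_isometry => /dotp_eq0 n00.
  by rewrite n00 eqxx in n0.
exists (Num.min e s'); first by rewrite lt_min e0.
move=> x; rewrite lt_min => /andP[xe xs] nx.
apply/hG' => //.
have near : `|lsubmx (x *m Q : 'rV[R]_(2 + 1)) - w0| < s'.
  apply: le_lt_trans xs; apply: rV_norm_le; first exact: enorm_ge0.
  move=> i; rewrite /w0; have := coord_le_enorm ((x - p) *m Q) (@lshift 2 1 i).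
  by rewrite enorm_isometry mulmxBl !mxE.
(* Here the plane is itself a graph: [x] and the chart point over the same base point satisfy its
   equation, so their last coordinates agree. *)
have := pl _ near; rewrite -nx nE => h.
apply: (mulfI m2); apply/esym.
apply: (addrI (\sum_(i < 2) m 0 (@lshift 2 1 i) * (x *m Q) 0 (@lshift 2 1 i))).
by rewrite -h; congr (_ + _); apply: eq_bigr => i _; rewrite [in RHS]mxE.
Qed.

(** In the orthonormal coordinates of the graph, the projection to the base plane has 1-Lipschitz
    components and covers a square. *)
Lemma surface_nonnull (r : R) : G p -> 0 < r ->
  ~ null_set (G `&` [set x | enorm (x - p) < r]).
Proof.
move=> Gp r0; have [QQ L0 hL e0 hG'] := hG.
have [s s0 hs] := chart_near Gp.
have c0 : 0 < 3 * (1 + L) by lra.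
pose s' := Num.min s (r / (3 * (1 + L))).
have s'0 : 0 < s' by rewrite lt_min s0 divr_gt0.
pose f (i : 'I_2) x := (x *m Q) 0 (@lshift 2 1 i).
have fl i x y : `|f i x - f i y| <= enorm (x - y).
  have := coord_le_enorm ((x - y) *m Q) (@lshift 2 1 i).
  by rewrite enorm_isometry mulmxBl mxE [X in _ + X]mxE.
apply: (@square_image_nonnull _ _ (f 0) (f 1) (w0 0 0) (w0 0 1) (s' / 2)) => //.
  by rewrite divr_gt0.
move=> a b ha hb; pose w : 'rV[R]_2 := \row_i (if i == 0 then a else b).
have ww : `|w - w0| < s'.
  apply: (@le_lt_trans _ _ (s' / 2)); last lra.
  apply: rV_norm_le; first by apply: ltW; rewrite divr_gt0.
  move=> i; rewrite mxE [X in _ + X]mxE [w _ _]mxE.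
  have [i0|i0] : i = 0 \/ i = 1.
    by case: i => [[|[|]]] // ?; [left|right]; apply: val_inj.
  - by rewrite i0 eqxx; apply: ltW.
  - by rewrite i0 /=; apply: ltW.
move: (ww); rewrite lt_min => /andP[w1 w2]; have [_ Gw] := hs _ w1.
exists (chart w); split; last 2 first.
- by rewrite /f chart_coord mxE.
- by rewrite /f chart_coord mxE.
split=> //=; apply: le_lt_trans (chart_dist w Gp) _.
by rewrite mulrA mulrC -ltr_pdivlMr.
Qed.
End Graph.
End Topology.

(** * Elements of a consistent surface *)

Section Consistent.
Variable R : realType.
Implicit Types (x y z n p : pt R) (S G Omega : set (pt R)) (c e : R).

Lemma hull_on_bary v (g : 'I_4 -> pt R) (b : 'I_4 -> R) (A : {set 'I_4}) x :
  bary_coords v g b -> hull_on v A x <->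
  (forall j, 0 <= bary g b j x) /\ (forall j, j \notin A -> bary g b j x = 0).
Proof.
move=> hv; split; last first.
  by move=> [h1 h2]; have [e1 e2] := hv.2 x; exists (fun j => bary g b j x).
move=> [w [w0 wA w1 ->]].
have bw j : bary g b j (\sum_i w i *: v i) = w j.
  rewrite bary_sum // (bigD1 j) //= hv.1 eqxx mulr1 big1 ?addr0 // => i ij.
  by rewrite hv.1 (negbTE ij) mulr0.
by split=> [j|j jA]; rewrite bw //; exact: wA.
Qed.

(** A coordinate that vanishes inside a segment and is nonnegative at both ends vanishes at the
    ends. *)
Lemma face_extreme F S x y z (t : R) : face_of F S -> F x -> S y -> S z ->
  0 < t < 1 -> x = (1 - t) *: y + t *: z -> F y.
Proof.
move=> [v [iv SE [A FE]]]; have [g [b hv]] := bary_coords_exist iv.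
rewrite FE SE => /(hull_on_bary _ _ hv)[_ xA] /(hull_bary _ hv) y0 /(hull_bary _ hv) z0.
move=> /andP[t0 t1] xE; apply/(hull_on_bary _ _ hv); split=> // j /xA.
rewrite xE bary_line; have := y0 j; have := z0 j => zj yj; nra.
Qed.

Lemma tetrahedron_closed S : tetrahedron S -> forall x, ~ S x ->
  exists2 e, 0 < e & forall y, enorm (y - x) < e -> ~ S y.
Proof.
move=> [v iv SE] x; have [g [b hv]] := bary_coords_exist iv; rewrite SE => nS.
have [j /negP] : exists j, ~ 0 <= bary g b j x.
  by apply: contrapT => h; apply: nS; apply/(hull_bary _ hv) => j;
    apply: contrapT => hj; apply: h; exists j.
rewrite -ltNge => bj; have gj : 0 < enorm (g j) by rewrite enorm_gt0 (gradient_neq0 _ hv).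
exists (- bary g b j x / enorm (g j)); first by rewrite divr_gt0 // oppr_gt0.
move=> y; rewrite ltr_pdivlMr // => h /(hull_bary _ hv) /(_ j).
have := baryB g b j y x; have := cauchy_schwarz (g j) (y - x) => h1 h2 h3.
clear SE nS; lra.
Qed.

Lemma finite_near (I : choiceType) (D : set I) (P : I -> pt R -> Prop) x :
  finite_set D ->
  (forall i, D i -> exists2 e, 0 < e & forall y, enorm (y - x) < e -> P i y) ->
  exists2 e, 0 < e & forall i, D i -> forall y, enorm (y - x) < e -> P i y.
Proof.
move=> /finite_seqP[s ->]; elim: s => [|i s IH] h; first by exists 1.
have [|e e0 he] := IH; first by move=> j js; apply: h; rewrite /= inE js orbT.
have [|e' e0' he'] := h i; first by rewrite /= inE eqxx.
exists (Num.min e e'); first by rewrite lt_min e0.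
move=> j; rewrite /= inE => /orP[/eqP ->|js] y; rewrite lt_min => /andP[h1 h2].
  exact: he'.
exact: he.
Qed.

Lemma finite_pos_min (f : 'I_4 -> R) :
  exists2 e, 0 < e & forall j, 0 < f j -> e <= f j.
Proof.
pose h a := if 0 < a then a else (1 : R).
have h0 a : 0 < h a by rewrite /h; case: ifP.
have hE a : 0 < a -> h a = a by rewrite /h => ->.
exists (Num.min (Num.min (h (f 0)) (h (f 1))) (Num.min (h (f 2)) (h (f 3)))).
  by rewrite !lt_min !h0.
by apply: ord4_cases => fj; rewrite !ge_min (hE _ fj) lexx ?orbT.
Qed.

Variables (Omega : set (pt R)) (T : set (set (pt R))) (G : set (pt R)).
Hypotheses (hT : triangulation Omega T) (GO : G `<=` Omega)
  (hG : lipschitz_surface G) (hC : consistent T G).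

(** Local finiteness leaves finitely many tetrahedra near [x]; as these are closed, a smaller
    neighbourhood avoids those that do not contain [x]. *)
Lemma near_covered x : exists2 e, 0 < e &
  exists2 D, finite_set D & (forall S, D S -> T S /\ S x) /\
    forall y, enorm (y - x) < e -> G y -> exists2 S, D S & S y.
Proof.
have [tT cov _ lf] := hT.
have [U /nbhs_enorm[e e0 hU] fD] := lf x.
set D := [set S | T S /\ S `&` U !=set0] in fD.
have [|e' e'0 he'] := finite_near (P := fun S y => S y -> S x) (x := x) fD.
  move=> S [TS _]; have [Sx|nS] := pselect (S x); first by exists 1.
  by have [d d0 hd] := tetrahedron_closed (tT _ TS) nS; exists d => // y /hd.
exists (Num.min e e'); first by rewrite lt_min e0.
exists (D `&` [set S | S x]); first exact: finite_setIl.
split=> [S [[TS _] Sx] //|y]; rewrite lt_min => /andP[y1 y2] Gy.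
have : closure Omega y by apply: subset_closure; exact: GO.
rewrite cov => -[S TS Sy]; have DS : D S by split=> //; exists y; split=> //; exact: hU.
by exists S => //; split=> //; exact: he' Sy.
Qed.

(** Intersections of measure zero yield no triangles, yet the triangles must cover the surface. If
    all tetrahedra through [x] met the surface in null sets, a neighbourhood of [x] in it would be a
    finite union of null sets. *)
Lemma surface_in_element x : G x -> exists2 S, T S & S x /\ (0 < meas2 (S `&` G))%E.
Proof.
move=> Gx; apply: contrapT => nS.
have [e e0 [D fD [hD cov]]] := near_covered x.
have [Q [g [L [e' hg]]]] := lipschitz_surface_graph hG Gx.
apply: (surface_nonnull hg Gx e0).
apply: (@null_set_sub _ _ (\bigcup_(S in D) (S `&` G))).
  by move=> y [Gy /cov] /(_ Gy)[S DS Sy]; exists S.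
apply: null_set_bigcup => // S DS; have [TS Sx] := hD _ DS.
apply: contrapT => /meas2_gt0 h; apply: nS; by exists S.
Qed.

(** * The element of one tetrahedron fills its plane section *)

Section Element.
Variables (v : 'I_4 -> pt R) (n : pt R) (c : R)
  (g : 'I_4 -> pt R) (b : 'I_4 -> R).
Hypotheses (TS : T (hull v)) (hv : bary_coords v g b)
  (SG : ~ null_set (hull v `&` G)) (n0 : n != 0)
  (hn : hull v `&` G `<=` [set x | dotp n x = c]).

Let E := slice v n c.

Lemma hull_bounded A : A `<=` hull v -> ~ null_set A -> noncollinear A.
Proof.
move=> AS nA; apply: (noncollinear_nonnull nA (B := outer_diam (hull v))).
by move=> x y /AS + /AS; exact: edist_outer_diam.
Qed.

Lemma element_sub_slice : hull v `&` G `<=` E.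
Proof. by move=> x h; split; [case: h | exact: hn]. Qed.

(** The section may lie in a facet, where one coordinate vanishes identically; only the remaining
    coordinates have to be positive in the relative interior. *)
Definition essential (j : 'I_4) : Prop := exists2 y, E y & bary g b j y != 0.

Definition slice_interior x : Prop :=
  E x /\ forall j, essential j -> 0 < bary g b j x.

(** Otherwise the parts of the element on facets with essential [j] cover it. Each part is null:
    three noncollinear points in it would make the plane of the section that of the facet, and [j]
    would not be essential. *)
Lemma slice_interior_exists : exists2 x, G x & slice_interior x.
Proof.
apply: contrapT => h; apply: SG.
apply: (@null_set_sub _ _ (\bigcup_(j in essential)
    (hull v `&` G `&` [set x | bary g b j x = 0]))).
  move=> x Sx; apply: contrapT => hx; apply: h; exists x; first by case: Sx.
  split; first exact: element_sub_slice.
  move=> j ej; have [Sx1 _] := Sx.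
  rewrite lt_def (hull_bary _ hv).1 // andbT; apply/eqP => bj; apply: hx.
  by exists j.
apply: null_set_bigcup; first exact: finite_finset.
move=> j [y [_ /= ny] /eqP yj]; apply: contrapT => nn.
have [x1 [x2 [x3 [h1 h2 h3 ne nc]]]] : noncollinear (hull v `&` G `&` [set x | bary g b j x = 0]).
  by apply: hull_bounded nn => x [[]].
have pl x : (hull v `&` G `&` [set x | bary g b j x = 0]) x -> dotp n x = c /\ dotp (g j) x = - b j.
  by move=> [h4 /=]; rewrite /bary => h5; split; [exact: hn|lra].
have [a1 c1] := pl _ h1; have [a2 c2] := pl _ h2; have [a3 c3] := pl _ h3.
have := plane_subset n0 a1 a2 a3 c1 c2 c3 ne nc ny => gy.
by apply: yj; rewrite /bary; lra.
Qed.

(** The segment from [y] to [x] is prolonged by the factor [e], the least positive coordinate of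
    [x]. As coordinates of [y] are at most 1, none becomes negative. *)
Lemma slice_interior_extend x y : slice_interior x -> E y ->
  exists z (t : R), [/\ hull v z, 0 < t < 1 & x = (1 - t) *: y + t *: z].
Proof.
move=> [[xS _] xi] Ey; have [yS _] := Ey.
have [e e0 he] := finite_pos_min (fun j => bary g b j x).
have e1 : 0 < 1 + e by lra.
exists (x + e *: (x - y)), (1 / (1 + e)); split.
- apply/(hull_bary _ hv) => j.
  have -> : bary g b j (x + e *: (x - y)) = bary g b j x + e * (bary g b j x - bary g b j y).
    by rewrite /bary !dotpE; ring.
  have xj := (hull_bary _ hv).1 xS j; have yj := bary_le1 j hv yS.
  have [y0|y0] := eqVneq (bary g b j y) 0; first by rewrite y0; nra.
  have xp : 0 < bary g b j x by apply: xi; exists y.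
  have := he _ xp; nra.
- by rewrite divr_gt0 //= ltr_pdivrMr // mul1r ltrDl.
- by apply/rowP => k; rewrite !mxE; field; exact: lt0r_neq0.
Qed.

(** For a tetrahedron [S'] through [x], the common face contains [x], which is inside a segment from
    any point of the section; as faces are extreme, [S'] contains the whole section. Three
    noncollinear points of the element then identify the plane of the surface in [S']. *)
Lemma slice_interior_open x : G x -> slice_interior x ->
  exists2 e, 0 < e & forall y, enorm (y - x) < e -> dotp n y = c -> G y.
Proof.
move=> Gx xi; have [e e0 [D _ [hD cov]]] := near_covered x.
have [Q [f [L [e' hf]]]] := lipschitz_surface_graph hG Gx.
apply: (surface_eq_plane hf Gx n0 e0) => y ye Gy.
have [S' DS' S'y] := cov _ ye Gy; have [TS' S'x] := hD _ DS'.
have [_ _ fT _] := hT.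
have [xE _] := xi.
have xS : hull v x by case: xE.
have ES' : E `<=` S'.
  move=> u Eu; have [z [t [Sz t01 xt]]] := slice_interior_extend xi Eu.
  have Su : hull v u by case: Eu.
  have F := (fT _ _ TS TS').1.
  by have [] := face_extreme F (conj xS S'x) Su Sz t01 xt.
have GS' : hull v `&` G `<=` S' `&` G.
  by move=> u h; split; [apply: ES'; exact: element_sub_slice|case: h].
have nS' : (0 < meas2 (S' `&` G))%E.
  by apply/meas2_gt0 => h; apply: SG; exact: null_set_sub h.
have [n' [c' [n0' hn']]] := hC TS' nS'.
have [x1 [x2 [x3 [h1 h2 h3 ne nc]]]] := hull_bounded (@subIsetl _ (hull v) G) SG.
have := plane_subset n0' (hn' _ (GS' _ h1)) (hn' _ (GS' _ h2)) (hn' _ (GS' _ h3))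
  (hn h1) (hn h2) (hn h3) ne nc; apply.
by apply: hn'.
Qed.

Lemma element_eq_slice : hull v `&` G = E.
Proof.
apply/seteqP; split; first exact: element_sub_slice.
move=> y Ey; split; first by case: Ey.
have [x Gx xi] := slice_interior_exists.
have [[xS xn] xp] := xi.
have [yS yn] := Ey.
pose z t := (1 - t) *: x + t *: y.
have zn t : dotp n (z t) = c by rewrite /z !dotpE xn yn; ring.
have z1 : z 1 = y by rewrite /z subrr scale0r add0r scale1r.
have z0 : z 0 = x by rewrite /z subr0 scale1r scale0r addr0.
have near e t : 0 < e -> exists2 d, 0 < d & forall s, `|s - t| < d -> enorm (z s - z t) < e.
  move=> e0; have p0 : 0 < 1 + enorm (y - x) by rewrite ltr_pwDl ?enorm_ge0.
  exists (e / (1 + enorm (y - x))); first by rewrite divr_gt0.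
  move=> s; rewrite ltr_pdivlMr // => h.
  have -> : z s - z t = (s - t) *: (y - x).
    by apply/rowP => k; rewrite !mxE; ring.
  rewrite enormZ; apply: le_lt_trans h; rewrite ler_wpM2l // lerDr; lra.
rewrite -z1; apply: (@unit_interval_ind R (fun t => G (z t))).
- by rewrite z0.
- move=> t /andP[t0 t1] Gz.
  (* For [t < 1] the segment from the interior point [x] stays in the relative interior. *)
  have zi : slice_interior (z t).
    split.
      split; last exact: zn.
      apply/(hull_bary _ hv) => j; rewrite bary_line.
      by rewrite addr_ge0 // mulr_ge0 ?(hull_bary _ hv).1 // subr_ge0 ltW.
    move=> j /xp xj; rewrite bary_line ltr_wpDr //.
      by rewrite mulr_ge0 // (hull_bary _ hv).1.
    by rewrite mulr_gt0 // subr_gt0.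
  have [e e0 he] := slice_interior_open Gz zi; have [d d0 hd] := near e t e0.
  by exists d => // s /hd h; apply: he.
- move=> t _ nG; have [e e0 he] := closed_far hG.1 nG.
  by have [d d0 hd] := near e t e0; exists d => // s /hd /he.
Qed.
End Element.

Lemma element_slice S : T S -> (0 < meas2 (S `&` G))%E ->
  exists v n c, [/\ aff_indep v, S = hull v, n != 0, S `&` G = slice v n c &
    noncollinear (slice v n c)].
Proof.
move=> TS hS; have [tT _ _ _] := hT.
have [v iv SE] := tT _ TS; have [g [b hv]] := bary_coords_exist iv.
have SG : ~ null_set (S `&` G) by apply/meas2_gt0.
have [n [c [n0 hn]]] := hC TS hS.
rewrite SE in TS SG hn *.
exists v, n, c; split=> //; rewrite -?(element_eq_slice TS hv SG n0 hn) //.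
exact: hull_bounded (@subIsetl _ (hull v) G) SG.
Qed.
End Consistent.

(** * Division of the elements *)

Section Division.
Variable R : realType.
Implicit Types (q : 'I_4 -> pt R) (t : 'I_3 -> pt R).

Lemma hull_comb3 (m : nat) (p : 'I_m -> pt R) (x y z : pt R) (r s u : R) :
  hull p x -> hull p y -> hull p z -> 0 <= r -> 0 <= s -> 0 <= u ->
  r + s + u = 1 -> hull p (r *: x + s *: y + u *: z).
Proof.
move=> hx hy hz r0 s0 u0 e.
have h : hull (tnth [tuple x; y; z]) `<=` hull p.
  by apply: hull_sub; apply: ord3_cases; rewrite tnth3.
apply: h; exists (tnth [tuple r; s; u]); split=> [|i||]; last 2 first.
- by rewrite sum_ord3 !tnth3.
- by rewrite sum_ord3 !tnth3.
- by apply: ord3_cases; rewrite tnth3.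
- by rewrite inE.
Qed.

Lemma convex_quad_diagonals q k : convex_quad q -> exists s u : R,
  [/\ 0 < s < 1, 0 < u < 1 &
    (1 - s) *: q k + s *: q (k + 2) = (1 - u) *: q (k + 1) + u *: q (k + 3)].
Proof.
move=> [_ [s [u [s01 u01 e]]]].
have flip (r : R) : 0 < r < 1 -> 0 < 1 - r < 1.
  by move=> /andP[h1 h2]; rewrite subr_gt0 h2 ltrBlDr ltrDl.
have E (i j l : 'I_4) : val (i + j) = val l -> i + j = l by move=> ?; exact: val_inj.
elim/ord4_cases: k.
- by exists s, u; rewrite (E 0 2 2) // (E 0 1 1) // (E 0 3 3).
- exists u, (1 - s); split=> //; first exact: flip.
  by rewrite (E 1 2 3) // (E 1 1 2) // (E 1 3 0) // -e subKr addrC.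
- exists (1 - s), (1 - u); split; [exact: flip|exact: flip|].
  by rewrite (E 2 2 0) // (E 2 1 3) // (E 2 3 1) // !subKr addrC e addrC.
- exists (1 - u), s; split=> //; first exact: flip.
  by rewrite (E 3 2 1) // (E 3 1 0) // (E 3 3 2) // subKr addrC e.
Qed.

Lemma hull_range (m k : nat) (p : 'I_m -> pt R) (p' : 'I_k -> pt R) :
  range p `<=` range p' -> hull p `<=` hull p'.
Proof.
move=> h; apply: hull_sub => i; have [|j _ <-] := h (p i); first by exists i.
exact: hull_vertex.
Qed.

(* A multiple of the relation between the diagonals is added to the convex
   combination until the weight of k + 1 or of k + 3 vanishes. *)
Lemma convex_quad_split q k t1 t2 : convex_quad q ->
  range t1 = [set q k; q (k + 1); q (k + 2)] ->
  range t2 = [set q k; q (k + 2); q (k + 3)] ->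
  hull q = hull t1 `|` hull t2.
Proof.
move=> cq r1 r2; apply/seteqP; split; last first.
  move=> x []; apply: hull_range; rewrite ?r1 ?r2 => _ [[]|] ->;
    by eexists.
move=> x /hullW[w [w0 w1 ->]].
have [s [u [/andP[s0 s1] /andP[u0 u1] e]]] := convex_quad_diagonals k cq.
have ve (t : 'I_3 -> pt R) y : range t y -> hull t y.
  by move=> [i _ <-]; exact: hull_vertex.
have ks : injective (fun i : 'I_4 => k + i) by exact: addrI.
move: w1; rewrite (reindex_inj ks) /= sum_ord4 addr0 => w1.
rewrite (reindex_inj ks) /= sum_ord4 addr0.
set a := w k in w1 *; set b := w (k + 1) in w1 *.
set c := w (k + 2) in w1 *; set d := w (k + 3) in w1 *.
have [a0 b0 c0 d0] : [/\ 0 <= a, 0 <= b, 0 <= c & 0 <= d] by split; exact: w0.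
have un : u != 0 by exact: lt0r_neq0.
have u1n : 1 - u != 0 by apply: lt0r_neq0; lra.
have [h|h] := leP (b * u) (d * (1 - u)).
  right; have [r rE] : exists r, r = b / (1 - u) by eexists.
  have r0 : 0 <= r by rewrite rE divr_ge0 //; lra.
  have rb : r * (1 - u) = b by rewrite rE divfK.
  have -> : a *: q k + b *: q (k + 1) + c *: q (k + 2) + d *: q (k + 3) =
      (a + r * (1 - s)) *: q k + (c + r * s) *: q (k + 2) + (d - r * u) *: q (k + 3).
    have := congr1 (fun y => r *: y) e; rewrite /= !scalerDr !scalerA rb => e'.
    have -> : b *: q (k + 1) = (r * (1 - s)) *: q k + (r * s) *: q (k + 2)
       - (r * u) *: q (k + 3) by rewrite e' addrK.
    apply/rowP => l; rewrite !mxE; move: (q k 0 l) (q (k + 2) 0 l) (q (k + 3) 0 l) => X Y Z.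
    by clearbody a b c d; ring.
  apply: hull_comb3; try by apply: ve; rewrite r2 /=; auto.
  - by rewrite addr_ge0 // mulr_ge0 //; lra.
  - by rewrite addr_ge0 // mulr_ge0 //; lra.
  - rewrite subr_ge0 rE mulrAC ler_pdivrMr //; lra.
  - lra.
left; have [r rE] : exists r, r = d / u by eexists.
have r0 : 0 <= r by rewrite rE divr_ge0 // ltW.
have rb : r * u = d by rewrite rE divfK.
have -> : a *: q k + b *: q (k + 1) + c *: q (k + 2) + d *: q (k + 3) =
    (a + r * (1 - s)) *: q k + (b - r * (1 - u)) *: q (k + 1) + (c + r * s) *: q (k + 2).
  have := congr1 (fun y => r *: y) e; rewrite /= !scalerDr !scalerA rb => e'.
  have -> : d *: q (k + 3) = (r * (1 - s)) *: q k + (r * s) *: q (k + 2)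
     - (r * (1 - u)) *: q (k + 1) by rewrite e' addrAC subrr add0r.
  apply/rowP => l; rewrite !mxE; move: (q k 0 l) (q (k + 1) 0 l) (q (k + 2) 0 l) => X Y Z.
  by clearbody a b c d; ring.
apply: hull_comb3; try by apply: ve; rewrite r1 /=; auto.
- by rewrite addr_ge0 // mulr_ge0 //; lra.
- rewrite subr_ge0 rE mulrAC ler_pdivrMr //; lra.
- by rewrite addr_ge0 // mulr_ge0 //; lra.
- lra.
Qed.

(** The shape computed from the plane is compared with the shape claimed by the division: the number
    of extreme points excludes a mismatch, and the classification excludes [division_other]. *)
Lemma slice_division v (g : 'I_4 -> pt R) (b : 'I_4 -> R) (n : pt R) (c rho a : R)
    (D : set ('I_3 -> pt R)) :
  bary_coords v g b -> n != 0 -> noncollinear (slice v n c) -> 1 <= a ->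
  (forall i j, enorm (v i - v j) <= rho) -> (forall j, enorm (g j) * rho <= a) ->
  division (slice v n c) D ->
  slice v n c = \bigcup_(t in D) hull t /\
  forall t, D t -> forall i, 0 < inner_angle t i <= acos (cosmin a).
Proof.
move=> hv n0 nc a1 hr hg hD.
have shape := slice_shape hv n0 nc.
case: hD shape => {D} [t it Et|q k t1 t2 cq Eq hk r1 r2|n3 n4] shape.
- split; first by rewrite bigcup_set1.
  move=> _ -> i.
  case: shape => [[t' [ct' Et']]|[q' [cq' dq' Eq']]].
    have ct := tri_config_match ct' it (etrans (esym Et) Et').
    apply: (tri_config_good hv a1 hr hg ct).
    + by rewrite -subr_eq0 addrAC subrr add0r oppr_eq0.
    + by rewrite -subr_eq0 addrAC subrr add0r.
    + by elim/ord3_cases: i.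
  have := hull_leq_card (convex_quad_cvx (quad_config_convex hv cq' dq')) (etrans (esym Eq') Et).
  by [].
- split; first by rewrite bigcup_setU !bigcup_set1 Eq; exact: convex_quad_split r1 r2.
  case: shape => [[t' [ct' Et']]|[q' [cq' dq' Eq']]].
    by have := hull_leq_card (convex_quad_cvx cq) (etrans (esym Eq) Et').
  have hq := quad_config_match hv cq' cq (etrans (esym Eq) Eq').
  have qi := cvx_indep_inj (convex_quad_cvx cq).
  have dif (i j : 'I_4) : i != j -> q (k + i) != q (k + j).
    by move=> ij; rewrite (inj_eq qi) (inj_eq (addrI k)).
  have d01 := dif 0 1 isT; have d02 := dif 0 2 isT; have d03 := dif 0 3 isT.
  have d12 := dif 1 2 isT; have d23 := dif 2 3 isT; rewrite addr0 in d01 d02 d03.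
  have [h1 h2 h3] := quad_config_half hv a1 hr hg hq hk.
  have [h4 h5 h6] := quad_config_half' hv a1 hr hg hq hk.
  move=> t [] -> i.
    apply: (triangle_range (Phi := good_angle a) _ d01 d12 d02 r1) => //.
    + by move=> ? ? ?; exact: good_angleC.
  apply: (triangle_range (Phi := good_angle a) _ d02 d23 d03 r2) => //.
  + by move=> ? ? ?; exact: good_angleC.
  + exact: good_angleC.
- exfalso; case: shape => [[t' [ct' Et']]|[q' [cq' dq' Eq']]].
    by apply: n3; exists t' => //; exact: tri_config_indep hv _ ct'.
  by apply: n4; exists q' => //; exact: quad_config_convex hv _ cq' dq'.
Qed.
End Division.

Theorem theorem3p2 (R : realType) (alpha : R) :
  exists phi_min : R, 0 < phi_min /\
  forall (Omega : set (pt R)) (T : R -> set (set (pt R)))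
    (Gamma : R -> set (pt R)) (F : R -> set ('I_3 -> pt R)),
  domain Omega ->
  regular_family Omega alpha T ->
  (forall h, 0 < h ->
    [/\ Gamma h `<=` Omega, Gamma h !=set0, connected (Gamma h),
        lipschitz_surface (Gamma h) & consistent (T h) (Gamma h)]) ->
  (forall h, 0 < h -> surface_triangulation (T h) (Gamma h) (F h)) ->
  forall h, 0 < h ->
    Gamma h = \bigcup_(t in F h) hull t /\
    forall i : 'I_3,
      (0 < ereal_sup [set (inner_angle t i)%:E | t in F h])%E /\
      (ereal_sup [set (inner_angle t i)%:E | t in F h] <= (pi - phi_min)%:E)%E.
Proof.
(* The angle is fixed before any family is given, and [cosmin_bounds] requires [1 <= a]. *)
pose a := Num.max 1 alpha.
have a1 : 1 <= a by rewrite le_max lexx.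
have /andP[c1 c0] := cosmin_bounds a1.
exists (pi - acos (cosmin a)); split.
  by rewrite subr_gt0 acos_ltpi // c1 (le_trans c0).
move=> Omega T Gamma F _ [hT hreg] hG hF h h0.
have [GO [x0 Gx0] _ hL hC] := hG h h0.
have [D [hD ->]] := hF h h0.
have key S : T h S -> (0 < meas2 (S `&` Gamma h))%E ->
    S `&` Gamma h = \bigcup_(t in D S) hull t /\
    forall t, D S t -> forall i, 0 < inner_angle t i <= acos (cosmin a).
  move=> TS mS; have dS := hD S TS mS.
  have [v [n [c [iv SE n0 e nc]]]] := element_slice (hT h h0) GO hL hC TS mS.
  have [g [b hv]] := bary_coords_exist iv.
  rewrite e in dS *.
  apply: (slice_division (rho := outer_diam (hull v)) hv n0 nc a1 _ _ dS).
    by move=> i j; apply: edist_outer_diam; exact: hull_vertex.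
  move=> j; apply: gradient_bound iv hv _.
  rewrite -SE le_max; apply/orP; right.
  rewrite -lee_fin; apply: le_trans hreg; apply: ereal_sup_ubound.
  by exists S => //; exists h.
have inE x : Gamma h x -> exists S t,
    [/\ T h S, (0 < meas2 (S `&` Gamma h))%E, D S t & hull t x].
  move=> Gx; have [S TS [Sx mS]] := surface_in_element (hT h h0) GO hL Gx.
  have [e _] := key S TS mS.
  have : (S `&` Gamma h) x by [].
  by rewrite e => -[t Dt tx]; exists S, t.
split.
  apply/seteqP; split=> x.
    by move=> /inE[S [t [TS mS Dt tx]]]; exists t => //; exists S.
  move=> [t [S [TS mS] Dt] tx]; have [e _] := key S TS mS.
  have : (S `&` Gamma h) x by rewrite e; exists t.
  by case.
move=> i; split.
  (* A point of the surface provides a triangle; the supremum over no triangles would be minus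
     infinity. *)
  have [S [t [TS mS Dt _]]] := inE x0 Gx0; have [_ good] := key S TS mS.
  have /andP[p _] := good t Dt i.
  apply: (@lt_le_trans _ _ (inner_angle t i)%:E); first by rewrite lte_fin.
  by apply: ereal_sup_ubound; exists t => //; exists S.
apply: ge_ereal_sup => _ [t [S [TS mS] Dt] <-].
have [_ good] := key S TS mS; have /andP[_ p] := good t Dt i.
by rewrite lee_fin subKr.
Qed.
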